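(* Let $Q_4 = [-1,1]^4 \subset \mathbb{R}^4$. If a unit vector $\mathbf{a} \in S^3$ is a critical direction (that is, $Q_4 \cap \mathbf{a}^\perp$ is a critical central hyperplane section of $Q_4$), then either $\mathbf{a}$ is a diagonal direction, or $\mathbf{a} = \frac{1}{\sqrt{10}}(1,1,2,2)$ up to permuting coordinates and changing signs.
   Context: $S^{3}$ is the Euclidean unit sphere of $\mathbb{R}^4$, $\mathbf{a}^\perp = \{\mathbf{x} \in \mathbb{R}^4 : \langle \mathbf{x}, \mathbf{a}\rangle = 0\}$, and $\mathrm{Vol}_{3}$ denotes 3-dimensional volume (Hausdorff measure) in $\mathbb{R}^4$. A unit vector $\mathbf{a} \in S^{3}$ is a critical direction if it is a critical point of the function $V : S^{3} \to \mathbb{R}$, $V(\mathbf{a}) = \mathrm{Vol}_{3}(Q_4 \cap \mathbf{a}^\perp)$, in the usual sense: either $V$ is differentiable at $\mathbf{a}$ (as a function on the sphere) and its differential vanishes there, or $V$ is not differentiable at $\mathbf{a}$. For $1 \leq k \leq 4$, a unit vector in $\mathbb{R}^4$ is a $k$-diagonal direction if, up to permuting the coordinates and changing signs, it is of the form $(\frac{1}{\sqrt k}, \ldots, \frac{1}{\sqrt k}, 0, \ldots, 0)$ with exactly $k$ non-zero coordinates; it is a diagonal direction if it is a $k$-diagonal direction for some $1 \leq k \leq 4$. *)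

(* Defs.v *)
From HB Require Import structures.
From mathcomp Require Import all_boot all_order all_algebra all_fingroup.
From mathcomp Require Import all_classical all_reals all_analysis.

Set Implicit Arguments.
Unset Strict Implicit.
Unset Printing Implicit Defensive.

Import Order.TTheory GRing.Theory Num.Theory.
Import numFieldNormedType.Exports.

Local Open Scope classical_set_scope.
Local Open Scope ring_scope.

Section Euclidean.
Variables (R : realType) (n : nat).
Implicit Types (x y a b : 'rV[R]_n) (U : set 'rV[R]_n).

(* The library norm on row vectors is the sup norm, hence this section. *)
Definition dotp x y : R := \sum_(i < n) x 0 i * y 0 i.

Definition enorm x : R := Num.sqrt (dotp x x).

Definition usphere : set 'rV[R]_n := [set x | enorm x = 1].

Definition orthc a : set 'rV[R]_n := [set x | dotp x a = 0].

Definition cube : set 'rV[R]_n := [set x | forall i, -1 <= x 0 i <= 1].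

(* The point 0 is adjoined so that the empty set has diameter 0, not -oo. *)
Definition ediam U : \bar R :=
  ereal_sup ([set 0%E] `|` [set (enorm (p.1 - p.2))%:E | p in U `*` U]).

Definition hausdorff3_pre (delta : R) U : \bar R :=
  ereal_inf [set s : \bar R | exists F : nat -> set 'rV[R]_n,
    [/\ U `<=` \bigcup_i F i,
        forall i, (ediam (F i) <= delta%:E)%E
      & s = (\sum_(0 <= i <oo) ediam (F i) ^+ 3)%E]].

(* pi / 6 is the volume of a 3-dimensional ball of diameter 1: with this
   factor the measure agrees with Lebesgue measure on 3-dimensional
   subspaces. *)
Definition hausdorff3 U : \bar R :=
  (((pi / 6)%R)%:E *
   ereal_sup [set hausdorff3_pre delta U | delta in [set d : R | (0 < d)%R]])%E.

(* f is only evaluated on the unit sphere.  The differential at a is a linear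
   form on the tangent space orthc a; it is represented by a linear form L on
   the ambient space, of which only the restriction to orthc a matters (the
   component of b - a along a is quadratic in enorm (b - a)). *)
Definition is_sphere_diff (f : 'rV[R]_n -> R) a
    (L : {linear 'rV[R]_n -> R^o}) : Prop :=
  (fun b => (f b - f a - L (b - a)) / enorm (b - a))
    @ within usphere (dnbhs a) --> (0 : R).

Definition sphere_differentiable (f : 'rV[R]_n -> R) a : Prop :=
  exists L : {linear 'rV[R]_n -> R^o}, is_sphere_diff f a L.

Definition sphere_critical (f : 'rV[R]_n -> R) a : Prop :=
  (exists2 L : {linear 'rV[R]_n -> R^o},
     is_sphere_diff f a L & forall v, orthc a v -> L v = 0)
  \/ ~ sphere_differentiable f a.

Definition eq_upto_perm_sign a b : Prop :=
  exists (s : 'S_n) (e : 'I_n -> bool),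
    forall i, a 0 i = (-1) ^+ e i * b 0 (s i).

Definition diag_vec (k : nat) : 'rV[R]_n :=
  \row_(i < n) (if (i < k)%N then (Num.sqrt k%:R)^-1 else 0).

Definition is_kdiagonal (k : nat) a : Prop := eq_upto_perm_sign a (diag_vec k).

Definition is_diagonal a : Prop :=
  exists2 k : nat, (1 <= k <= n)%N & is_kdiagonal k a.

End Euclidean.

Definition section_vol (R : realType) (a : 'rV[R]_4) : R :=
  fine (hausdorff3 (@cube R 4 `&` orthc a)).

Definition critical_direction (R : realType) (a : 'rV[R]_4) : Prop :=
  usphere a /\ sphere_critical (@section_vol R) a.

Definition vec1122 (R : realType) : 'rV[R]_4 :=
  (Num.sqrt 10)^-1 *: \row_(i < 4) (if (i < 2)%N then 1 else 2).

(* Main.v *)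
Require Import Defs.
From HB Require Import structures.
From mathcomp Require Import all_boot all_order all_algebra all_fingroup.
From mathcomp Require Import all_classical all_reals all_analysis.
From mathcomp Require Import measurable_realfun ring lra.

(* A hyperplane [b^_|_] with last coordinate positive is a graph over space, and
   the Hausdorff measure of the graph over [E] is a constant times the volume
   of [E]: both set functions scale by [w ^ 3] on cubes, which already forces
   proportionality, because subadditivity gives one inequality on a set and the
   same inequality on its complement in a cube gives the other.  Rotations in
   coordinate planes identify the constant as [c / b_4] with [0 < c < oo]; the
   value of [c] is irrelevant for critical points.

   By symmetry let [0 <= a_1 <= a_2 <= a_3 <= a_4].  Integrating chord lengths
   gives the section volume near [a] as a combination of cubes of positive
   parts, which up to an error quadratic in the distance to [a] is
   [c (8 - W / (b_2 b_3)) / b_4], where, with [e = b_2 + b_3 - b_4], [W] is [0]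
   if [a_4 >= a_1 + a_2 + a_3], [2 e ^ 2 + 2 b_1 ^ 2 / 3] if
   [a_2 + a_3 >= a_1 + a_4], and [(e + b_1) ^ 3 / (3 b_1)] otherwise.  Hence the
   section volume is differentiable at every [a] that is not 2-diagonal, and
   the Lagrange equations of the three rational functions have only the
   announced solutions. *)

Set Implicit Arguments.
Unset Strict Implicit.
Unset Printing Implicit Defensive.

Import Order.TTheory GRing.Theory Num.Theory.
Import numFieldNormedType.Exports.

Local Open Scope classical_set_scope.
Local Open Scope ring_scope.

(** * Hausdorff premeasures *)

Section Hausdorff.
Variables (R : realType) (n : nat).
Implicit Types (U V : set 'rV[R]_n) (d k : R).
Local Open Scope ereal_scope.

(** All that is established about the Hausdorff measure is monotonicity, finite subadditivity and
    its behaviour under Lipschitz maps. This is why sections are encoded as sublevel sets of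
    Lipschitz functions with null zero level: the complement in a cube is then, up to a null set, of
    the same kind. A direction where the volume is not differentiable counts as critical, so
    differentiability must be shown at every direction to be excluded. The delicate places are the
    walls where the formula for W changes, and they cannot be avoided: (1,1,1,1) and (1,1,2,2) both
    lie on a_2 + a_3 = a_1 + a_4. The volume is therefore compared near [a] with a single rational
    function, and an error quadratic in the distance is enough to transfer the differential. The
    error is quadratic because every dropped term integrates the square of a positive part that
    vanishes at [a]. Each W is homogeneous of degree 2. Euler's relation then evaluates the Lagrange
    multiplier, and polynomial equations remain. *)

Lemma expe3_le (x y : \bar R) : 0 <= x -> x <= y -> x ^+ 3 <= y ^+ 3.
Proof.
move=> x0 xy; rewrite /expe /=; apply: lee_pmul => //; first exact: mule_ge0.
exact: lee_pmul.
Qed.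

Lemma expe3_M (x y : \bar R) : (x * y) ^+ 3 = x ^+ 3 * y ^+ 3.
Proof. by rewrite /expe /= (muleACA x y x y) (muleACA x y). Qed.

Lemma ediam_ge0 U : 0 <= ediam U.
Proof. by apply: ereal_sup_ubound; left. Qed.

Lemma enorm_le_ediam U x y : U x -> U y -> (enorm (x - y))%:E <= ediam U.
Proof. by move=> Ux Uy; apply: ereal_sup_ubound; right; exists (x, y). Qed.

Lemma ediam_le U k : (0 <= k)%R ->
  (forall x y, U x -> U y -> (enorm (x - y) <= k)%R) -> ediam U <= k%:E.
Proof.
move=> k0 Uk; apply: ge_ereal_sup => _ [->|[[x y] [/= Ux Uy] <-]].
  by rewrite lee_fin.
by rewrite lee_fin; exact: Uk.
Qed.

Lemma ediam_image (f : 'rV[R]_n -> 'rV[R]_n) k U : (0 < k)%R ->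
  (forall x y, (enorm (f x - f y) <= k * enorm (x - y))%R) ->
  ediam (f @` U) <= k%:E * ediam U.
Proof.
move=> k0 fk; apply: ge_ereal_sup => _ [->|[[_ _] [/= [x Ux <-] [y Uy <-]] <-]].
  by rewrite mule_ge0 ?ediam_ge0// lee_fin ltW.
apply: (@le_trans _ _ (k%:E * (enorm (x - y))%:E)).
  by rewrite -EFinM lee_fin.
by rewrite lee_pmul2l ?lte_fin// enorm_le_ediam.
Qed.

Lemma ediam0 : ediam (@set0 'rV[R]_n) = 0.
Proof. by apply/eqP; rewrite eq_le ediam_ge0 andbT ediam_le. Qed.

Lemma hausdorff3_pre_ge0 d U : 0 <= hausdorff3_pre d U.
Proof.
apply: le_ereal_inf_tmp => _ [F [_ _ ->]].
by apply: nneseries_ge0 => i _ _; rewrite expe_ge0 ?ediam_ge0.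
Qed.

Lemma hausdorff3_pre_le_cover d U (F : nat -> set 'rV[R]_n) :
  U `<=` \bigcup_i F i -> (forall i, ediam (F i) <= d%:E) ->
  hausdorff3_pre d U <= \sum_(0 <= i <oo) ediam (F i) ^+ 3.
Proof. by move=> UF Fd; apply: ereal_inf_lbound; exists F. Qed.

Lemma hausdorff3_pre_le d U V : U `<=` V -> hausdorff3_pre d U <= hausdorff3_pre d V.
Proof.
move=> UV; apply: le_ereal_inf_tmp => _ [F [VF Fd ->]].
by apply: hausdorff3_pre_le_cover => //; apply: subset_trans VF.
Qed.

Lemma hausdorff3_pre_antitone d d' U : (d <= d')%R ->
  hausdorff3_pre d' U <= hausdorff3_pre d U.
Proof.
move=> dd; apply: le_ereal_inf_tmp => _ [F [VF Fd ->]].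
by apply: hausdorff3_pre_le_cover => // i; apply: (le_trans (Fd i)); rewrite lee_fin.
Qed.

Lemma hausdorff3_pre_le_expn d U : ediam U <= d%:E -> hausdorff3_pre d U <= ediam U ^+ 3.
Proof.
move=> Ud; have d0 : 0 <= d%:E by apply: le_trans Ud; exact: ediam_ge0.
pose F (i : nat) : set 'rV[R]_n := if i == 0%N then U else set0.
have /le_trans : hausdorff3_pre d U <= \sum_(0 <= i <oo) ediam (F i) ^+ 3.
  apply: hausdorff3_pre_le_cover; first by move=> x Ux; exists 0%N.
  by case=> [|i] //=; rewrite ediam0.
apply; apply: lime_le.
  by apply: is_cvg_nneseries => i _ _; rewrite expe_ge0 ?ediam_ge0.
exists 1%N => // -[|i] //= _.
rewrite big_nat_recl//= big1 ?adde0// => j _.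
by rewrite ediam0 /expe /= mul0e.
Qed.

(** Covers of the two sets, each optimal up to e / 2, are interleaved into one sequence, whose
    partial sums of even length split exactly. Infinite values are settled first because a nearly
    optimal cover is extracted from a finite infimum. *)
Lemma hausdorff3_pre_setU d U V :
  hausdorff3_pre d (U `|` V) <= hausdorff3_pre d U + hausdorff3_pre d V.
Proof.
have [->|Ufin] := eqVneq (hausdorff3_pre d U) +oo.
  by rewrite addye ?leey// gt_eqF// (lt_le_trans _ (hausdorff3_pre_ge0 _ _)).
have [->|Vfin] := eqVneq (hausdorff3_pre d V) +oo.
  by rewrite addey ?leey// gt_eqF// (lt_le_trans _ (hausdorff3_pre_ge0 _ _)).
have fin (W : set 'rV[R]_n) : hausdorff3_pre d W != +oo -> hausdorff3_pre d W \is a fin_num.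
  by move=> ?; rewrite ge0_fin_numE ?hausdorff3_pre_ge0// ltey.
apply/lee_addgt0Pr => e e0.
have e2 : (0 < e / 2)%R by rewrite divr_gt0.
have [_ [F [UF Fd ->]] Fe] := lb_ereal_inf_adherent e2 (fin _ Ufin).
have [_ [G [VG Gd ->]] Ge] := lb_ereal_inf_adherent e2 (fin _ Vfin).
pose K i := if odd i then G i./2 else F i./2.
have cK : U `|` V `<=` \bigcup_i K i.
  move=> x [/UF[i _ Fx]|/VG[i _ Gx]].
    by exists i.*2 => //; rewrite /K odd_double doubleK.
  by exists i.*2.+1 => //; rewrite /K /= odd_double /= uphalf_double.
have Kd i : ediam (K i) <= d%:E by rewrite /K; case: ifP.
apply: (le_trans (hausdorff3_pre_le_cover cK Kd)).
have e3_ge0 (L : nat -> set 'rV[R]_n) i : 0 <= ediam (L i) ^+ 3.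
  by rewrite expe_ge0 ?ediam_ge0.
have Kle : \sum_(0 <= i <oo) ediam (K i) ^+ 3 <=
    \sum_(0 <= i <oo) ediam (F i) ^+ 3 + \sum_(0 <= i <oo) ediam (G i) ^+ 3.
  apply: lime_le; first by apply: is_cvg_nneseries => i _ _; exact: e3_ge0.
  apply: nearW => i.
  have E j : \sum_(0 <= l < j.*2) ediam (K l) ^+ 3 =
      \sum_(0 <= l < j) ediam (F l) ^+ 3 + \sum_(0 <= l < j) ediam (G l) ^+ 3.
    elim: j => [|j IH]; first by rewrite !big_nil adde0.
    rewrite doubleS !big_nat_recr//= IH /K /= odd_double /= doubleK.
    by rewrite uphalf_double -!addeA; congr (_ + _); rewrite addeCA.
  apply: (@le_trans _ _ (\sum_(0 <= l < i.*2) ediam (K l) ^+ 3)).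
    apply: lee_sum_nneg_natr; first by move=> *; exact: e3_ge0.
    by rewrite -addnn leq_addr.
  rewrite E; apply: leeD; apply: nneseries_lim_ge => *; exact: e3_ge0.
apply: (le_trans Kle).
have -> : e%:E = (e / 2)%:E + (e / 2)%:E by rewrite -EFinD -splitr.
by rewrite addeACA; apply: leeD; exact: ltW.
Qed.

(** The mesh is rescaled together with the set; the supremum over all meshes absorbs this change in
    [hausdorff3_image]. *)
Lemma hausdorff3_pre_image (f : 'rV[R]_n -> 'rV[R]_n) k d U : (0 < k)%R ->
  (forall x y, (enorm (f x - f y) <= k * enorm (x - y))%R) ->
  hausdorff3_pre (k * d) (f @` U) <= (k ^+ 3)%:E * hausdorff3_pre d U.
Proof.
move=> k0 fk.
rewrite /(hausdorff3_pre d U) -ereal_inf_pZl ?exprn_gt0//.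
apply: le_ereal_inf_tmp => _ [_ [F [UF Fd ->]] <-].
have /le_trans : hausdorff3_pre (k * d) (f @` U) <=
    \sum_(0 <= i <oo) ediam (f @` F i) ^+ 3.
  apply: hausdorff3_pre_le_cover.
    by move=> _ [x /UF[i _ Fx] <-]; exists i => //; exists x.
  move=> i; apply: (le_trans (ediam_image _ k0 fk)).
  by rewrite EFinM lee_pmul2l ?lte_fin.
apply; rewrite -nneseriesZl; last by move=> i _; rewrite expe_ge0 ?ediam_ge0.
apply: lee_nneseries => i; first by rewrite expe_ge0 ?ediam_ge0.
move=> _; apply: (@le_trans _ _ ((k%:E * ediam (F i)) ^+ 3)).
  by rewrite expe3_le// ?ediam_ge0// ediam_image.
by rewrite EFin_expe expe3_M.
Qed.

Lemma pi6_gt0 : (0 < pi / 6 :> R)%R.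
Proof. by rewrite divr_gt0 ?pi_gt0. Qed.

Lemma ereal_sup_pre_ge0 U :
  0 <= ereal_sup [set hausdorff3_pre d U | d in [set d : R | (0 < d)%R]].
Proof.
apply: le_trans (hausdorff3_pre_ge0 1 U) _; apply: ereal_sup_ubound.
by exists 1%R => //=; exact: ltr01.
Qed.

Lemma hausdorff3_ge0 U : 0 <= hausdorff3 U.
Proof.
apply: mule_ge0; first by rewrite lee_fin ltW ?pi6_gt0.
exact: ereal_sup_pre_ge0.
Qed.

Lemma hausdorff3_le U V : U `<=` V -> hausdorff3 U <= hausdorff3 V.
Proof.
move=> UV; rewrite /hausdorff3 lee_pmul2l ?lte_fin ?pi6_gt0//.
apply: ge_ereal_sup => _ [d d0 <-]; apply: le_ereal_sup_tmp.
by exists (hausdorff3_pre d V); [exists d|exact: hausdorff3_pre_le].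
Qed.

Lemma hausdorff3U U V : hausdorff3 (U `|` V) <= hausdorff3 U + hausdorff3 V.
Proof.
rewrite /hausdorff3 -muleDr// ?ge0_adde_def ?inE ?ereal_sup_pre_ge0//.
rewrite lee_pmul2l ?lte_fin ?pi6_gt0//.
  apply: ge_ereal_sup => _ [d d0 <-]; apply: (le_trans (hausdorff3_pre_setU _ _ _)).
  by apply: leeD; apply: ereal_sup_ubound; exists d.
Qed.

Lemma hausdorff3_image (f : 'rV[R]_n -> 'rV[R]_n) k U : (0 < k)%R ->
  (forall x y, (enorm (f x - f y) <= k * enorm (x - y))%R) ->
  hausdorff3 (f @` U) <= (k ^+ 3)%:E * hausdorff3 U.
Proof.
move=> k0 fk; rewrite /hausdorff3 muleCA lee_pmul2l ?lte_fin ?pi6_gt0//.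
apply: ge_ereal_sup => _ [d d0 <-].
have -> : d = (k * (d / k))%R by rewrite mulrCA divff ?mulr1 ?gt_eqF.
apply: (le_trans (hausdorff3_pre_image _ _ k0 fk)).
rewrite lee_pmul2l ?lte_fin ?exprn_gt0//.
by apply: ereal_sup_ubound; exists (d / k)%R => //=; rewrite divr_gt0.
Qed.

Lemma hausdorff3_0 : hausdorff3 (@set0 'rV[R]_n) = 0.
Proof.
rewrite /hausdorff3 [X in _ * X](_ : _ = 0) ?mule0//.
apply/eqP; rewrite eq_le; apply/andP; split.
  apply: ge_ereal_sup => _ [d /= d0 <-].
  by rewrite (le_trans (hausdorff3_pre_le_expn _)) ?ediam0 /expe /= ?mul0e// lee_fin ltW.
exact: ereal_sup_pre_ge0.
Qed.

End Hausdorff.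

(** * Proportionality to volume *)

Section Volume.
Variable R : realType.
Local Notation mR := (measurableTypeR R).
Local Notation T := (mR * mR * mR)%type.

(* Lipschitz for the sup norm; [T] carries no norm, only its measurable structure. *)
Definition lip (K : R) (h : T -> R) := forall (x y : T) (d : R),
  `|x.1.1 - y.1.1| <= d -> `|x.1.2 - y.1.2| <= d -> `|x.2 - y.2| <= d ->
  h x <= h y + K * d.

Local Open Scope ereal_scope.

Definition vol3 : {measure set T -> \bar R} :=
  ((@lebesgue_measure R \x @lebesgue_measure R) \x @lebesgue_measure R)%E.

Lemma vol3_box (A B C : set mR) :
  measurable A -> measurable B -> measurable C ->
  vol3 (A `*` B `*` C) = lebesgue_measure A * lebesgue_measure B * lebesgue_measure C.
Proof.
move=> mA mB mC.
transitivity ((@lebesgue_measure R \x @lebesgue_measure R) (A `*` B) * lebesgue_measure C).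
  by apply: product_measure1E => //; exact: measurableX.
by congr (_ * _); exact: product_measure1E.
Qed.

(** Half-open, so that the eight cubes of half the side form an exact partition. *)
Definition hcube (p : T) (w : R) : set T :=
  (`[p.1.1, (p.1.1 + w)%R[ `*` `[p.1.2, (p.1.2 + w)%R[) `*` `[p.2, (p.2 + w)%R[.

Lemma hcubeP p w (x : T) : hcube p w x <->
  [/\ (p.1.1 <= x.1.1 < p.1.1 + w)%R, (p.1.2 <= x.1.2 < p.1.2 + w)%R &
      (p.2 <= x.2 < p.2 + w)%R].
Proof. by rewrite /hcube /= !in_itv /=; split => [[[]]|[]]. Qed.

Lemma measurable_hcube p w : measurable (hcube p w).
Proof. by apply: measurableX => //; exact: measurableX. Qed.

Lemma vol3_hcube p w : (0 < w)%R -> vol3 (hcube p w) = (w ^+ 3)%:E.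
Proof.
move=> w0; rewrite /hcube vol3_box// !lebesgue_measure_itv /= !lte_fin !ltrDl w0.
rewrite -!EFinB -!EFinM; congr (_%:E); ring.
Qed.

Definition subcube (p : T) (w : R) (b : bool * bool * bool) : set T :=
  hcube (p.1.1 + w / 2 * b.1.1%:R, p.1.2 + w / 2 * b.1.2%:R,
         p.2 + w / 2 * b.2%:R)%R (w / 2).

Lemma hcube_split p w :
  hcube p w = \big[setU/set0]_(b : bool * bool * bool) subcube p w b.
Proof.
rewrite -bigcup_seq; apply/seteqP; split => x.
  move=> /hcubeP[h1 h2 h3].
  exists ((p.1.1 + w / 2 <= x.1.1)%R, (p.1.2 + w / 2 <= x.1.2)%R,
    (p.2 + w / 2 <= x.2)%R) => /=; first by rewrite mem_index_enum.
  move/andP: h1 => [? ?]; move/andP: h2 => [? ?]; move/andP: h3 => [? ?].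
  apply/hcubeP => /=; split; apply/andP.
  - by case: (lerP (p.1.1 + w / 2)%R x.1.1) => /= ?; split; lra.
  - by case: (lerP (p.1.2 + w / 2)%R x.1.2) => /= ?; split; lra.
  - by case: (lerP (p.2 + w / 2)%R x.2) => /= ?; split; lra.
move=> [[[b1 b2] b3] _ /hcubeP /= [/andP[l1 u1] /andP[l2 u2] /andP[l3 u3]]].
apply/hcubeP; split; apply/andP.
- by case: b1 l1 u1 => /= l1 u1; split; lra.
- by case: b2 l2 u2 => /= l2 u2; split; lra.
- by case: b3 l3 u3 => /= l3 u3; split; lra.
Qed.

Lemma trivIset_subcube p w (X : set T) :
  trivIset setT (fun b => subcube p w b `&` X).
Proof.
have E (a c : R) (b b' : bool) : (a + w / 2 * b%:R <= c < a + w / 2 * b%:R + w / 2)%R ->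
    (a + w / 2 * b'%:R <= c < a + w / 2 * b'%:R + w / 2)%R -> b = b'.
  by move: b b' => [] [] //= /andP[? ?] /andP[? ?]; lra.
move=> [[b1 b2] b3] [[c1 c2] c3] _ _ [x [[/hcubeP /= [h1 h2 h3] _]]].
move=> [/hcubeP /= [k1 k2 k3] _].
by congr (_, _, _); [exact: E h1 k1|exact: E h2 k2|exact: E h3 k3].
Qed.

Lemma vol3_split p w (X : set T) : measurable X ->
  vol3 (hcube p w `&` X) =
  \sum_(b : bool * bool * bool) vol3 (subcube p w b `&` X).
Proof.
move=> mX; rewrite hcube_split -bigcup_seq setI_bigcupl measure_fin_bigcup//.
- by rewrite -fsbig_seq// index_enum_uniq.
- exact: sub_trivIset (@trivIset_subcube p w X).
- by move=> b _; apply: measurableI => //; exact: measurable_hcube.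
Qed.

Section SetFunction.
(* [Phi] is a set function on subsets of space, merely subadditive, which is
   proportional to volume on cubes. *)
Variables (Phi : set T -> \bar R) (kappa : R).
Hypothesis Phi_le : forall A B : set T, A `<=` B -> Phi A <= Phi B.
Hypothesis PhiU : forall A B : set T, Phi (A `|` B) <= Phi A + Phi B.
Hypothesis Phi0 : Phi set0 = 0.
Hypothesis Phi_hcube : forall p w, (0 < w)%R -> Phi (hcube p w) = (kappa * w ^+ 3)%:E.

Lemma kappa_ge0 : (0 <= kappa)%R.
Proof.
have : Phi set0 <= Phi (hcube (0%R, 0%R, 0%R) 1) by exact: Phi_le.
by rewrite Phi0 Phi_hcube// expr1n mulr1 lee_fin.
Qed.

Lemma Phi_bigU (I : Type) (r : seq I) (F : I -> set T) :
  Phi (\big[setU/set0]_(i <- r) F i) <= \sum_(i <- r) Phi (F i).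
Proof.
elim: r => [|i r IH]; first by rewrite !big_nil Phi0.
by rewrite !big_cons (le_trans (PhiU _ _))// leeD2l.
Qed.

Section Sublevel.
Variables (h : T -> R) (K : R).
Hypothesis mh : measurable_fun setT h.
Hypothesis K0 : (0 <= K)%R.
Hypothesis hK : lip K h.

Lemma measurable_sublevel c : measurable [set x | (h x <= c)%R].
Proof.
rewrite [X in measurable X](_ : _ = setT `&` h @^-1` `]-oo, c]).
  exact: mh.
by rewrite setTI; apply/seteqP; split => x /=; rewrite in_itv.
Qed.

(** A cube of side w that meets h <= 0 lies inside h <= K * w by the Lipschitz bound, so it can be
    replaced by the full cube, where [Phi] is known; a cube that misses the set contributes nothing.
    Halving n times first reduces the enlargement of the level to K * w / 2 ^ n. *)
Lemma cube_sublevel_le_approx n p w : (0 < w)%R ->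
  Phi (hcube p w `&` [set x | (h x <= 0)%R]) <=
  kappa%:E * vol3 (hcube p w `&` [set x | (h x <= K * (w / 2 ^+ n))%R]).
Proof.
elim: n p w => [|n IH] p w w0.
  have [[y [/hcubeP[y1 y2 y3] /= hy]]|H] := pselect (exists y, hcube p w y /\ (h y <= 0)%R).
    rewrite [X in vol3 X](_ : _ = hcube p w).
      rewrite vol3_hcube// -EFinM -(Phi_hcube p w0); apply: Phi_le; exact: subIsetl.
    apply/seteqP; split => x //=; first by case.
    move=> xp; split => //; case/hcubeP: xp => x1 x2 x3.
    have /le_trans : (h x <= h y + K * w)%R by apply: hK; rewrite ler_norml; lra.
    by apply; rewrite expr0 divr1; lra.
  rewrite [X in Phi X](_ : _ = set0).
    by rewrite Phi0 mule_ge0// lee_fin kappa_ge0.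
  by rewrite -subset0 => x /= ?; apply: H; exists x.
have w2 : (0 < w / 2)%R by rewrite divr_gt0.
rewrite vol3_split; last exact: measurable_sublevel.
rewrite ge0_sume_distrr//; rewrite hcube_split -bigcup_seq setI_bigcupl bigcup_seq.
apply: le_trans (Phi_bigU _ _) _; apply: lee_sum => b _.
apply: le_trans (IH _ _ w2) _.
by have -> : (w / 2 ^+ n.+1 = w / 2 / 2 ^+ n)%R by rewrite exprS invfM mulrA.
Qed.

(** The enlarged sets decrease to the sublevel set, and volume is continuous from above. *)
Lemma cube_sublevel_le p w : (0 < w)%R ->
  Phi (hcube p w `&` [set x | (h x <= 0)%R]) <=
  kappa%:E * vol3 (hcube p w `&` [set x | (h x <= 0)%R]).
Proof.
move=> w0.
pose F n := hcube p w `&` [set x | (h x <= K * (w / 2 ^+ n))%R].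
have mF n : measurable (F n).
  by apply: measurableI; [exact: measurable_hcube|exact: measurable_sublevel].
have FE : \bigcap_n F n = hcube p w `&` [set x | (h x <= 0)%R].
  apply/seteqP; split => x /=; last first.
    move=> [px hx] n _; split=> //=; apply: le_trans hx _.
    by rewrite mulr_ge0// divr_ge0// ?exprn_ge0// ltW.
  move=> Fx; split; first by case: (Fx 0%N I).
  rewrite leNgt; apply/negP => hx.
  (* Since 2 ^ n > n > K * w / h x, a point with h x > 0 is outside the n-th enlarged set. *)
  pose n := (Num.Def.trunc (K * w / h x)).+1.
  have [_ /=] := Fx n I; apply/negP; rewrite -ltNge mulrA.
  rewrite ltr_pdivrMr ?exprn_gt0// [ltRHS]mulrC -ltr_pdivrMr//.
  apply: (@lt_trans _ _ (n%:R : R)); first exact: truncnS_gt.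
  by rewrite -natrX ltr_nat ltn_expl.
have : (vol3 \o F) x @[x --> \oo] --> vol3 (\bigcap_n F n).
  apply: nonincreasing_cvg_mu => //.
  - rewrite (@le_lt_trans _ _ (vol3 (hcube p w)))//.
      by apply: le_measure; rewrite ?inE//; [exact: measurable_hcube|exact: subIsetl].
    by rewrite vol3_hcube// ltry.
  - exact: bigcap_measurable.
  - move=> m n mn; apply/subsetPset => x [px /= hx]; split => //=.
    apply: le_trans hx _; rewrite ler_wpM2l// ler_pM2l// lef_pV2 ?posrE ?exprn_gt0//.
    by rewrite ler_weXn2l// ler1n.
rewrite FE => /(@cvgeZl _ _ _ _ _ kappa%:E isT) cv.
rewrite -(cvg_lim _ cv)//; apply: lime_ge; first exact: cvgP cv.
by apply: nearW => n; exact: cube_sublevel_le_approx.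
Qed.
End Sublevel.

Lemma proportional_sublevel (h : T -> R) (K : R) p w : measurable_fun setT h -> (0 <= K)%R ->
  lip K h ->
  (0 < w)%R -> [set x | (h x <= 0)%R] `<=` hcube p w ->
  vol3 [set x | h x = 0%R] = 0 ->
  Phi [set x | (h x <= 0)%R] = kappa%:E * vol3 [set x | (h x <= 0)%R].
Proof.
move=> mh K0 hK w0 hp h0.
set E := [set x | (h x <= 0)%R].
have EE : hcube p w `&` E = E by rewrite setIC; exact/setIidPl.
(* Taken closed, so that it is again a sublevel set, this time of [- h]. Its overlap with [E] is the
   null set h = 0, hence the volumes of [E] and [F] add up to that of the cube. *)
set F := hcube p w `&` [set x | (- h x <= 0)%R].
have mE : measurable E by exact: measurable_sublevel.
have mF : measurable F.
  apply: measurableI; first exact: measurable_hcube.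
  by apply: measurable_sublevel; exact: measurableT_comp.
have leE : Phi E <= kappa%:E * vol3 E.
  by rewrite -EE; exact: (cube_sublevel_le mh K0 hK).
have leF : Phi F <= kappa%:E * vol3 F.
  apply: (@cube_sublevel_le (fun x => - h x)%R K) => //.
    exact: measurableT_comp.
  move=> x y d *; have : (h y <= h x + K * d)%R by apply: hK; rewrite distrC.
  lra.
have EF : hcube p w = E `|` F.
  apply/seteqP; split => x; last by case => [/hp|[]].
  by move=> px; have [hx|hx] := leP (h x) 0%R; [left|right; split=> //=; lra].
have finsub (A : set T) : measurable A -> A `<=` hcube p w -> vol3 A \is a fin_num.
  move=> mA Ap; rewrite ge0_fin_numE// (@le_lt_trans _ _ (vol3 (hcube p w)))//.
    by apply: le_measure; rewrite ?inE//; exact: measurable_hcube.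
  by rewrite vol3_hcube// ltry.
have finE : vol3 E \is a fin_num by exact: finsub.
have finF : vol3 F \is a fin_num by apply: finsub => // x [].
have volEF : vol3 E + vol3 F = (w ^+ 3)%:E.
  rewrite -(vol3_hcube p w0) EF measureUfinl//.
    rewrite (_ : E `&` F = [set x | h x = 0%R]) ?h0 ?sube0//.
    apply/seteqP; split => x /=; first by move=> [/= hx1 [_ hx2]]; apply/eqP; rewrite eq_le hx1 -oppr_le0.
    by move=> hx; split; [|split; [apply: hp|]]; rewrite /E /= hx ?oppr0.
  by rewrite -ge0_fin_numE.
have PEF : (kappa * w ^+ 3)%:E <= Phi E + Phi F.
  by rewrite -(Phi_hcube p w0) EF PhiU.
apply/eqP; rewrite eq_le leE /=.
have : kappa%:E * vol3 E + kappa%:E * vol3 F <= Phi E + kappa%:E * vol3 F.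
  rewrite -muleDr// ?volEF//; last by rewrite fin_num_adde_defl.
  by rewrite -EFinM; apply: (le_trans PEF); rewrite leeD2l.
by rewrite leeD2rE// fin_numM.
Qed.
End SetFunction.
End Volume.
Arguments vol3 {R}.

(** * Graphs over space *)

Section Lift.
Variable R : realType.
Local Notation mR := (measurableTypeR R).
Local Notation T := (mR * mR * mR)%type.
Implicit Types (x y : 'rV[R]_4) (m p q : T).

Definition co x (k : nat) : R := x 0 (inord k).

Definition vec4 (a b c d : R) : 'rV[R]_4 := \row_(i < 4) [:: a; b; c; d]`_i.

Lemma co_vec4 a b c d :
  [/\ co (vec4 a b c d) 0 = a, co (vec4 a b c d) 1 = b,
      co (vec4 a b c d) 2 = c & co (vec4 a b c d) 3 = d].
Proof. by rewrite /co !mxE !inordK. Qed.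

Lemma ord4E (i : 'I_4) : [\/ i = inord 0, i = inord 1, i = inord 2 | i = inord 3].
Proof.
case: i => -[|[|[|[|//]]]] hi; [apply: Or41|apply: Or42|apply: Or43|apply: Or44];
  by apply: val_inj; rewrite /= inordK.
Qed.

Lemma co_inj x y : co x 0 = co y 0 -> co x 1 = co y 1 -> co x 2 = co y 2 ->
  co x 3 = co y 3 -> x = y.
Proof.
by move=> h0 h1 h2 h3; apply/rowP => i; case: (ord4E i) => ->.
Qed.

Lemma dotpE x y : dotp x y =
  co x 0 * co y 0 + co x 1 * co y 1 + co x 2 * co y 2 + co x 3 * co y 3.
Proof.
rewrite /dotp !big_ord_recl big_ord0 addr0 !addrA /co.
by do 3?congr (_ + _); congr (x _ _ * y _ _); apply: val_inj; rewrite /= inordK.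
Qed.

Lemma coB x y k : co (x - y) k = co x k - co y k.
Proof. by rewrite /co !mxE. Qed.
Lemma coD x y k : co (x + y) k = co x k + co y k.
Proof. by rewrite /co !mxE. Qed.
Lemma coZ (c : R) y k : co (c *: y) k = c * co y k.
Proof. by rewrite /co !mxE. Qed.

Lemma dotp_ge0 x : 0 <= dotp x x.
Proof. by rewrite dotpE !addr_ge0// -expr2 sqr_ge0. Qed.

Lemma enorm_sqr x : enorm x ^+ 2 = dotp x x.
Proof. by rewrite sqr_sqrtr// dotp_ge0. Qed.

Lemma enorm_le k x y : 0 <= k -> dotp x x <= k ^+ 2 * dotp y y ->
  enorm x <= k * enorm y.
Proof.
move=> k0 h; rewrite -[X in _ <= X * _](ger0_norm k0) -sqrtr_sqr.
by rewrite -sqrtrM ?sqr_ge0// ler_wsqrtr.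
Qed.

Lemma norm_co_le x k : `|co x k| <= enorm x.
Proof.
rewrite -sqrtr_sqr ler_wsqrtr// dotpE.
rewrite /co; case: (ord4E (inord k)) => ->; rewrite -!expr2 -/(co x 0) -/(co x 1) -/(co x 2) -/(co x 3);
  have := sqr_ge0 (co x 0); have := sqr_ge0 (co x 1);
  have := sqr_ge0 (co x 2); have := sqr_ge0 (co x 3); lra.
Qed.

Lemma enorm_le_norm x (d : R) : 0 <= d -> (forall i, `|x 0 i| <= d) -> enorm x <= 2 * d.
Proof.
move=> d0 h; rewrite -[leRHS]ger0_norm ?mulr_ge0// -sqrtr_sqr ler_wsqrtr// dotpE.
have E k : co x k * co x k <= d ^+ 2.
  by have := h (inord k); rewrite ler_norml -/(co x k) => /andP[? ?]; nra.
have := E 0%N; have := E 1%N; have := E 2%N; have := E 3%N; lra.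
Qed.

(** The graph is the hyperplane with normal (m, 1), so [m] holds the first three coordinates of a
    normal vector divided by the last one. *)
Definition lift m p : 'rV[R]_4 :=
  vec4 p.1.1 p.1.2 p.2 (- (m.1.1 * p.1.1 + m.1.2 * p.1.2 + m.2 * p.2)).

Definition affine3 p (w : R) (q : T) : T :=
  ((p.1.1 + w * q.1.1, p.1.2 + w * q.1.2), p.2 + w * q.2)%R.

Lemma lift_affine3 m p w q : lift m (affine3 p w q) = lift m p + w *: lift m q.
Proof.
have [? ? ? ?] := co_vec4 p.1.1 p.1.2 p.2 (- (m.1.1 * p.1.1 + m.1.2 * p.1.2 + m.2 * p.2)).
apply/rowP => i; rewrite !mxE.
by case: i => -[|[|[|[|//]]]] hi //=; ring.
Qed.

Lemma hcube_affine3 p w : 0 < w -> hcube p w = affine3 p w @` hcube (0, 0, 0) 1.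
Proof.
move=> w0; apply/seteqP; split => x; last first.
  move=> [y /hcubeP /= [/andP[? ?] /andP[? ?] /andP[? ?]] <-].
  by apply/hcubeP => /=; split; apply/andP; split; nra.
move=> /hcubeP [/andP[? ?] /andP[? ?] /andP[? ?]].
exists (((x.1.1 - p.1.1) / w, (x.1.2 - p.1.2) / w), (x.2 - p.2) / w).
  apply/hcubeP => /=; split; apply/andP; split;
    by rewrite ?divr_ge0 ?add0r ?ltr_pdivrMr// ?(ltW w0); lra.
rewrite /affine3 /=; have wn : w != 0 by rewrite gt_eqF.
rewrite [RHS](_ : x = ((x.1.1, x.1.2), x.2)); last by case: (x) => [[]].
by congr (_, _, _); field.
Qed.

Local Open Scope ereal_scope.

Definition lift_vol m (E : set T) : \bar R := hausdorff3 (lift m @` E).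

Lemma lift_vol_le m (A B : set T) : A `<=` B -> lift_vol m A <= lift_vol m B.
Proof. by move=> AB; apply: hausdorff3_le; exact: image_subset. Qed.

Lemma lift_volU m (A B : set T) : lift_vol m (A `|` B) <= lift_vol m A + lift_vol m B.
Proof. by rewrite /lift_vol image_setU; exact: hausdorff3U. Qed.

Lemma lift_vol0 m : lift_vol m set0 = 0.
Proof. by rewrite /lift_vol image_set0 hausdorff3_0. Qed.

Lemma enorm_affine (u : 'rV[R]_4) (w : R) x y : (0 <= w)%R ->
  (enorm ((u + w *: x) - (u + w *: y)) <= w * enorm (x - y))%R.
Proof.
move=> w0; apply: enorm_le => //.
by rewrite !dotpE !coB !coD !coZ le_eqVlt; apply/orP; left; apply/eqP; ring.
Qed.

Lemma lift_image_affine3 m p w (E : set T) :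
  lift m @` (affine3 p w @` E) = (fun x => lift m p + w *: x)%R @` (lift m @` E).
Proof.
by rewrite !image_comp; apply: eq_imagel => q _ /=; exact: lift_affine3.
Qed.

(** Through [lift m] the homothety of space becomes a homothety of R^4 with ratio w. Its Lipschitz
    bound gives one inequality, that of its inverse the other. *)
Lemma lift_vol_affine3 m p w (E : set T) : (0 < w)%R ->
  lift_vol m (affine3 p w @` E) = (w ^+ 3)%:E * lift_vol m E.
Proof.
move=> w0; rewrite /lift_vol lift_image_affine3; apply/eqP; rewrite eq_le; apply/andP; split.
  by apply: hausdorff3_image => // x y; apply: enorm_affine; exact: ltW.
set U := lift m @` E; set f := (fun x => _).
have E2 : U = (fun x => - (w^-1 *: lift m p) + w^-1 *: x)%R @` (f @` U).
  rewrite image_comp -[LHS]image_id; apply: eq_imagel => x _ /=.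
  by rewrite /f scalerDr scalerA mulVf ?gt_eqF// scale1r addKr.
have wV : (0 < w^-1)%R by rewrite invr_gt0.
have : hausdorff3 U <= (w^-1 ^+ 3)%:E * hausdorff3 (f @` U).
  by rewrite {1}E2; apply: hausdorff3_image => // x y; apply: enorm_affine; exact: ltW.
rewrite -(@lee_pmul2l _ (w ^+ 3)%:E) ?lte_fin ?exprn_gt0//.
by rewrite [X in _ <= X -> _]muleA -EFinM -exprMn mulfV ?gt_eqF// expr1n mul1e.
Qed.

Lemma lift_vol_hcube_affine m p w : (0 < w)%R ->
  lift_vol m (hcube p w) = (w ^+ 3)%:E * lift_vol m (hcube (0, 0, 0)%R 1).
Proof. by move=> w0; rewrite hcube_affine3// lift_vol_affine3. Qed.

Lemma lift_image_lift0 m (E : set T) :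
  lift m @` E = (fun x => vec4 (co x 0) (co x 1) (co x 2)
    (- (m.1.1 * co x 0 + m.1.2 * co x 1 + m.2 * co x 2))%R) @` (lift (0, 0, 0)%R @` E).
Proof.
rewrite image_comp; apply: eq_imagel => q _ /=.
by rewrite /lift; have [-> -> -> _] := co_vec4 q.1.1 q.1.2 q.2
   (- (0 * q.1.1 + 0 * q.1.2 + 0 * q.2))%R.
Qed.

(** Carries finiteness from the flat cube to all slopes. The map from the flat copy to the graph is
    extended to all of R^4; its norm is sqrt (1 + |m|^2), and the larger constant 1 + |m|^2 avoids
    the root. *)
Lemma lift_vol_le_flat m (E : set T) :
  lift_vol m E <= ((1 + m.1.1 ^+ 2 + m.1.2 ^+ 2 + m.2 ^+ 2) ^+ 3)%:E * lift_vol (0, 0, 0)%R E.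
Proof.
rewrite {1}/lift_vol lift_image_lift0; set f := (X in hausdorff3 (X @` _)).
apply: (@hausdorff3_image _ _ f).
  by rewrite !ltr_wpDr// sqr_ge0.
move=> x y; apply: enorm_le; first by rewrite !addr_ge0// sqr_ge0.
rewrite !dotpE !coB.
have fE z : [/\ co (f z) 0 = co z 0, co (f z) 1 = co z 1, co (f z) 2 = co z 2 &
    co (f z) 3 = (- (m.1.1 * co z 0 + m.1.2 * co z 1 + m.2 * co z 2))%R].
  exact: co_vec4.
have [-> -> -> ->] := fE x; have [-> -> -> ->] := fE y.
move: m.1.1 m.1.2 m.2 => a b c.
set u := (co x 0 - co y 0)%R; set v := (co x 1 - co y 1)%R; set w := (co x 2 - co y 2)%R.
set z := (co x 3 - co y 3)%R.
have -> : (- (a * co x 0 + b * co x 1 + c * co x 2) -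
  - (a * co y 0 + b * co y 1 + c * co y 2) = - (a * u + b * v + c * w))%R.
  by rewrite /u /v /w; ring.
set M := (1 + a ^+ 2 + b ^+ 2 + c ^+ 2)%R; set S := (u ^+ 2 + v ^+ 2 + w ^+ 2)%R.
have M1 : (1 <= M)%R by rewrite /M -!addrA lerDl !addr_ge0// sqr_ge0.
have S0 : (0 <= S)%R by rewrite /S !addr_ge0// sqr_ge0.
(* Cauchy-Schwarz, read off from Lagrange's identity. *)
have cs : ((a * u + b * v + c * w) ^+ 2 <= (M - 1) * S)%R.
  rewrite -subr_ge0 (_ : _ - _ = (a * v - b * u) ^+ 2 + (a * w - c * u) ^+ 2 +
    (b * w - c * v) ^+ 2)%R; last by rewrite /M /S; ring.
  by rewrite !addr_ge0// sqr_ge0.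
have z0 : (0 <= z ^+ 2)%R by exact: sqr_ge0.
have -> : (u * u + v * v + w * w + - (a * u + b * v + c * w) * - (a * u + b * v + c * w) =
  S + (a * u + b * v + c * w) ^+ 2)%R by rewrite /S; ring.
have -> : (u * u + v * v + w * w + z * z = S + z ^+ 2)%R by rewrite /S; ring.
apply: (@le_trans _ _ (M * S)%R); first by move: cs; lra.
rewrite -subr_ge0 (_ : _ - _ = M * ((M - 1) * S) + M ^+ 2 * z ^+ 2)%R; last by ring.
have M0 : (0 <= M)%R by apply: le_trans M1.
by rewrite addr_ge0// mulr_ge0// ?sqr_ge0// mulr_ge0// subr_ge0.
Qed.

End Lift.

(** * The Hausdorff measure of the flat unit cube is positive and finite *)

Section Flat.
Variable R : realType.
Local Notation mR := (measurableTypeR R).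
Local Notation T := (mR * mR * mR)%type.
Implicit Types (x y : 'rV[R]_4) (m p q : T).
Local Open Scope ereal_scope.

Definition zero3 : T := (0, 0, 0)%R.

Let Q := lift zero3 @` hcube zero3 1.

Lemma co_lift m p : [/\ co (lift m p) 0 = p.1.1, co (lift m p) 1 = p.1.2,
  co (lift m p) 2 = p.2 &
  co (lift m p) 3 = (- (m.1.1 * p.1.1 + m.1.2 * p.1.2 + m.2 * p.2))%R].
Proof. exact: co_vec4. Qed.

Lemma lift_zero3 p : co (lift zero3 p) 3 = 0%R.
Proof. by have [_ _ _ ->] := co_lift zero3 p; rewrite /= !mul0r !addr0 oppr0. Qed.

(** The cube is the union of eight copies of itself at scale 1/2, and each has at most 1/8 of its
    premeasure once the mesh is halved too. So the premeasure does not grow as the mesh is halved,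
    which bounds the supremum over all meshes. *)
Lemma hausdorff3_pre_halve (d : R) : (0 <= d)%R -> hausdorff3_pre (1 / 2 * d) Q <= hausdorff3_pre d Q.
Proof.
move=> d0; have QE : Q = \big[setU/set0]_(b : bool * bool * bool) (lift zero3 @` subcube zero3 1 b).
  by rewrite /Q hcube_split -bigcup_seq image_bigcup bigcup_seq.
have H b : hausdorff3_pre (1 / 2 * d) (lift zero3 @` subcube zero3 1 b) <=
    ((1 / 2) ^+ 3)%:E * hausdorff3_pre d Q.
  rewrite /subcube hcube_affine3; last by lra.
  rewrite lift_image_affine3; apply: hausdorff3_pre_image; first by lra.
  by move=> x y; apply: enorm_affine; lra.
have {}QE : hausdorff3_pre (1 / 2 * d) Q <=
    \sum_(b : bool * bool * bool) ((1 / 2) ^+ 3)%:E * hausdorff3_pre d Q.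
  rewrite {1}QE; elim/big_ind2: _ => //.
  - by rewrite (le_trans (hausdorff3_pre_le_expn _)) ?ediam0 /expe /= ?mul0e ?lee_fin//; lra.
  - by move=> A a B b Aa Bb; rewrite (le_trans (hausdorff3_pre_setU _ _ _))// leeD.
apply: (le_trans QE).
rewrite -ge0_sume_distrr; last by move=> *; exact: hausdorff3_pre_ge0.
rewrite big_const card_prod card_prod card_bool /= addr0.
move: (hausdorff3_pre_ge0 d Q); case: (hausdorff3_pre d Q) => [r _||//].
  by rewrite -!EFinD -EFinM lee_fin; lra.
by move=> _; rewrite leey.
Qed.

Lemma hausdorff3_pre_unit_le8 k : hausdorff3_pre ((1 / 2) ^+ k * 2)%R Q <= 8%:E.
Proof.
elim: k => [|k IH]; last first.
  rewrite exprS -mulrA; apply: le_trans (hausdorff3_pre_halve _) IH.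
  by rewrite mulr_ge0// exprn_ge0.
rewrite expr0 mul1r.
have Q2 : ediam Q <= 2%:E.
  apply: ediam_le => // _ _ [p /hcubeP /= [p1 p2 p3] <-] [q /hcubeP /= [q1 q2 q3] <-].
  rewrite -[leRHS]mulr1; apply: enorm_le_norm => // i.
  have [l0 l1 l2 _] := co_lift zero3 p; have [k0 k1 k2 _] := co_lift zero3 q.
  have [l3 k3] := (lift_zero3 p, lift_zero3 q).
  case: (ord4E i) => ->; rewrite -/(co (_ - _) _) coB ?l0 ?l1 ?l2 ?l3 ?k0 ?k1 ?k2 ?k3 ler_norml; apply/andP; split; lra.
apply: (le_trans (hausdorff3_pre_le_expn Q2)); apply: (le_trans (expe3_le (ediam_ge0 _) Q2)).
by rewrite -EFin_expe lee_fin; lra.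
Qed.

Lemma lift_vol_flat_fin : lift_vol zero3 (hcube zero3 1) < +oo.
Proof.
rewrite /lift_vol -/Q /hausdorff3 lte_mul_pinfty ?lee_fin ?ltW ?pi6_gt0//.
apply: (@le_lt_trans _ _ 8%:E); last exact: ltry.
apply: ge_ereal_sup => _ [d /= d0 <-].
pose k := (Num.Def.trunc (2 / d)).+1.
apply: le_trans (hausdorff3_pre_unit_le8 k); apply: hausdorff3_pre_antitone.
rewrite expr_div_n expr1n mul1r mulrC ler_pdivrMr ?exprn_gt0// mulrC -ler_pdivrMr//.
apply: (@le_trans _ _ (k%:R : R)); first by apply/ltW; exact: truncnS_gt.
by rewrite -natrX ler_nat ltnW// ltn_expl.
Qed.

Lemma vol3_closed_box p (d : R) : (0 <= d)%R ->
  vol3 ((`[(p.1.1 - d)%R, (p.1.1 + d)%R]%classic : set mR) `*` (`[(p.1.2 - d)%R, (p.1.2 + d)%R]%classic : set mR) `*`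
        (`[(p.2 - d)%R, (p.2 + d)%R]%classic : set mR)) = (8 * d ^+ 3)%:E.
Proof.
move=> d0; rewrite vol3_box// !lebesgue_measure_itv /= !lte_fin.
have E (a : R) : (if (a - d < a + d)%R then (a + d)%:E - (a - d)%:E else 0) = (2 * d)%:E.
  case: ltP => ad; first by rewrite -EFinB; congr (_%:E); ring.
  by congr (_%:E); lra.
by rewrite !E -!EFinM; congr (_%:E); ring.
Qed.

(** The points of the flat copy that lie in a set of diameter d have their first three coordinates
    in a closed box of side 2 d, of volume 8 d ^ 3. As these boxes cover a cube of volume 1, the sum
    of the d ^ 3 over any cover is at least 1/8. *)
Lemma lift_vol_flat_gt0 : 0 < lift_vol zero3 (hcube zero3 1).
Proof.
rewrite /lift_vol -/Q /hausdorff3 mule_gt0// ?lte_fin ?pi6_gt0//.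
apply: (@lt_le_trans _ _ (8^-1)%:E); first by rewrite lte_fin invr_gt0.
apply: (@le_trans _ _ (hausdorff3_pre 1 Q)); last first.
  by apply: ereal_sup_ubound; exists 1%R => //=; exact: ltr01.
apply: le_ereal_inf_tmp => _ [F [QF F1 ->]].
pose d i := fine (ediam (F i)).
have dE i : ediam (F i) = (d i)%:E.
  by rewrite /d fineK// ge0_fin_numE ?ediam_ge0// (le_lt_trans (F1 i))// ltry.
have d0 i : (0 <= d i)%R by rewrite /d fine_ge0// ediam_ge0.
have /choice[B HB] : forall i, exists B : set T, [/\ measurable B,
    forall p, F i (lift zero3 p) -> B p & vol3 B <= (8 * d i ^+ 3)%:E].
  move=> i; have [[p Fp]|H] := pselect (exists p, F i (lift zero3 p)); last first.
    exists set0; split => //; first by move=> p Fp; apply: H; exists p.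
    by rewrite measure0 lee_fin mulr_ge0// exprn_ge0.
  exists ((`[(p.1.1 - d i)%R, (p.1.1 + d i)%R]%classic : set mR) `*` (`[(p.1.2 - d i)%R, (p.1.2 + d i)%R]%classic : set mR) `*`
        (`[(p.2 - d i)%R, (p.2 + d i)%R]%classic : set mR)); split.
  - by do 2 (apply: measurableX => //).
  - move=> q Fq; have := enorm_le_ediam Fq Fp; rewrite dE lee_fin => qp.
    have H k : (`|co (lift zero3 q) k - co (lift zero3 p) k| <= d i)%R.
      by rewrite -coB; exact: le_trans (norm_co_le _ _) qp.
    have [p0 p1 p2 _] := co_lift zero3 p; have [q0 q1 q2 _] := co_lift zero3 q.
    have := H 0%N; rewrite p0 q0 ler_norml => /andP[? ?].
    have := H 1%N; rewrite p1 q1 ler_norml => /andP[? ?].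
    have := H 2%N; rewrite p2 q2 ler_norml => /andP[? ?].
    by split; [split|]; rewrite /= in_itv /=; apply/andP; split; lra.
  - by rewrite vol3_closed_box.
have : vol3 (hcube zero3 1) <= \sum_(0 <= i <oo) vol3 (B i).
  apply: measure_sigma_subadditive.
  - by move=> i; case: (HB i).
  - exact: measurable_hcube.
  - move=> p hp; have [|i _ Fi] := QF (lift zero3 p); first by exists p.
    by exists i => //; case: (HB i) => _ + _; exact.
rewrite vol3_hcube// expr1n => H.
rewrite -(@lee_pmul2l _ 8%:E) ?lte_fin// -EFinM mulfV//.
apply: (le_trans H); rewrite -nneseriesZl; last by move=> i _; rewrite expe_ge0 ?ediam_ge0.
apply: lee_nneseries => // i _; case: (HB i) => _ _ /le_trans; apply.
by rewrite dE -EFin_expe -EFinM.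
Qed.

End Flat.

(** * Boxes and slabs as sublevel sets of Lipschitz functions *)

Section Boxes.
Variable R : realType.
Local Notation mR := (measurableTypeR R).
Local Notation T := (mR * mR * mR)%type.
Implicit Types (p : T).

Lemma lip_max (K : R) (h h' : T -> R) : lip K h -> lip K h' -> lip K (fun x => Num.max (h x) (h' x)).
Proof.
move=> H H' x y d a b c; rewrite ge_max; apply/andP; split.
  by apply: le_trans (H _ _ _ a b c) _; rewrite lerD2r le_max lexx.
by apply: le_trans (H' _ _ _ a b c) _; rewrite lerD2r le_max lexx orbT.
Qed.

Lemma lip_cst (K : R) (h : T -> R) c : lip K h -> lip K (fun x => h x + c).
Proof. by move=> H x y d a b e; rewrite addrAC lerD2r; exact: H. Qed.

Lemma lip_abs_linear (a1 a2 a3 b : R) :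
  lip (`|a1| + `|a2| + `|a3|) (fun x : T => `|a1 * x.1.1 + a2 * x.1.2 + a3 * x.2 + b|).
Proof.
move=> x y d h1 h2 h3.
have d0 : 0 <= d by apply: le_trans h1.
have -> : a1 * x.1.1 + a2 * x.1.2 + a3 * x.2 + b = (a1 * y.1.1 + a2 * y.1.2 + a3 * y.2 + b) +
  (a1 * (x.1.1 - y.1.1) + a2 * (x.1.2 - y.1.2) + a3 * (x.2 - y.2)) by ring.
apply: (le_trans (ler_normD _ _)); rewrite lerD2l.
apply: (le_trans (ler_normD _ _)); rewrite mulrDl; apply: lerD; last by rewrite normrM ler_wpM2l.
by apply: (le_trans (ler_normD _ _)); rewrite mulrDl; apply: lerD; rewrite normrM ler_wpM2l.
Qed.

Lemma lipW (K K' : R) (h : T -> R) : K <= K' -> lip K h -> lip K' h.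
Proof.
move=> KK H x y d a b c; apply: le_trans (H _ _ _ a b c) _.
by rewrite lerD2l ler_wpM2r//; apply: le_trans a.
Qed.

Lemma measurable_linear3 a1 a2 a3 b :
  measurable_fun setT (fun x : T => a1 * x.1.1 + a2 * x.1.2 + a3 * x.2 + b : R).
Proof.
apply: measurable_funD => //; apply: measurable_funD; [apply: measurable_funD|];
  apply: measurable_funM => //; by do ?apply: measurableT_comp.
Qed.

Lemma measurable_abs_linear a1 a2 a3 b :
  measurable_fun setT (fun x : T => `|a1 * x.1.1 + a2 * x.1.2 + a3 * x.2 + b| : R).
Proof. by apply: measurableT_comp => //; exact: measurable_linear3. Qed.

Let vol2 : {measure set (mR * mR) -> \bar R} :=
  (@lebesgue_measure R \x @lebesgue_measure R)%E.

Lemma vol3_xsection (A : set T) :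
  vol3 A = (\int[vol2]_x lebesgue_measure (xsection A x))%E.
Proof. by []. Qed.

Lemma xsection3 (A : set T) x1 x2 :
  xsection A (x1, x2) = [set z : mR | A (x1, x2, z)].
Proof. by apply/seteqP; split => z /=; rewrite /xsection /= inE. Qed.

Lemma vol3_null (A : set T) :
  (forall x1 x2, lebesgue_measure [set z : mR | A (x1, x2, z)] = 0%E) -> vol3 A = 0%E.
Proof.
move=> H; rewrite vol3_xsection.
have HH (x : mR * mR) : setT x -> lebesgue_measure (xsection A x) = 0%E.
  by case: x => x1 x2 _; rewrite xsection3.
exact: (@integral0_eq _ _ _ vol2 setT _ HH).
Qed.

Lemma vol3_iter (A : set T) (F : R -> R -> R) (a b : R) : measurable A ->
  (forall x1 x2, a <= x1 <= b -> a <= x2 <= b ->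
     lebesgue_measure [set z : mR | A (x1, x2, z)] = (F x1 x2)%:E) ->
  (forall x1 x2 z, A (x1, x2, z) -> a <= x1 <= b /\ a <= x2 <= b) ->
  vol3 A = (\int[lebesgue_measure]_(x in `[a, b])
             \int[lebesgue_measure]_(y in `[a, b]) (F x y)%:E)%E.
Proof.
move=> mA AF Aab.
pose G (z : mR * mR) : \bar R := lebesgue_measure (xsection A z).
have GE x1 x2 : G (x1, x2) = lebesgue_measure [set z : mR | A (x1, x2, z)].
  by rewrite /G xsection3.
have mG : measurable_fun setT G.
  exact: (@measurable_fun_xsection _ _ (mR * mR)%type mR R lebesgue_measure).
rewrite vol3_xsection.
transitivity (\int[lebesgue_measure]_x \int[lebesgue_measure]_y G (x, y))%E.
  exact: (@fubini_tonelli1 _ _ mR mR R lebesgue_measure lebesgue_measure G mG).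
rewrite [RHS]integral_mkcond; apply: eq_integral => x1 _; rewrite patchE.
case: ifPn; rewrite mem_setE in_itv /= => x1ab; last first.
  apply: integral0_eq => x2 _; rewrite GE (_ : [set _ | _] = set0) ?measure0//.
  by rewrite -subset0 => z /= /Aab[]; rewrite (negbTE x1ab).
rewrite [RHS]integral_mkcond; apply: eq_integral => x2 _; rewrite patchE.
case: ifPn; rewrite mem_setE in_itv /= => x2ab; first by rewrite GE AF.
rewrite GE (_ : [set _ | _] = set0) ?measure0//.
by rewrite -subset0 => z /= /Aab[_]; rewrite (negbTE x2ab).
Qed.

(** Several constraints merged into one function, so that [proportional_sublevel] applies to its
    sublevel set at 0. The conditions on the third coordinate enter through [v]. *)
Definition box_with (c rho : R) (v : T -> R) (x : T) : R :=
  Num.max (Num.max `|x.1.1 - c| `|x.1.2 - c|) (v x) + - rho.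

Lemma box_with_le0 c rho v x : (box_with c rho v x <= 0) =
  [&& c - rho <= x.1.1 <= c + rho, c - rho <= x.1.2 <= c + rho & v x <= rho].
Proof.
by rewrite /box_with subr_le0 !ge_max !ler_distl -andbA.
Qed.

Lemma lip_box_with c rho (v : T -> R) (K : R) : 0 <= K -> lip K v -> lip (1 + K) (box_with c rho v).
Proof.
move=> K0 vK; apply: lip_cst; apply: lip_max; last by apply: lipW vK; rewrite lerDr.
apply: (@lipW 1); first by rewrite lerDl.
apply: lip_max.
  have := @lip_abs_linear 1 0 0 (- c); rewrite normr1 normr0 !addr0.
  by move=> H x y d h1 h2 h3; have := H x y d h1 h2 h3; rewrite !mul1r !mul0r !addr0.
have := @lip_abs_linear 0 1 0 (- c); rewrite normr1 normr0 !addr0 !add0r.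
by move=> H x y d h1 h2 h3; have := H x y d h1 h2 h3; rewrite !mul1r !mul0r !addr0 !add0r.
Qed.

Lemma measurable_box_with c rho v : measurable_fun setT v ->
  measurable_fun setT (box_with c rho v).
Proof.
move=> mv; apply: measurable_funD => //; apply: measurable_maxr => //; apply: measurable_maxr.
  rewrite (_ : (fun _ => _) = (fun x : T => `|1 * x.1.1 + 0 * x.1.2 + 0 * x.2 + - c|)).
    exact: measurable_abs_linear.
  by apply/funext => x; rewrite mul1r !mul0r !addr0.
rewrite (_ : (fun _ => _) = (fun x : T => `|0 * x.1.1 + 1 * x.1.2 + 0 * x.2 + - c|)).
  exact: measurable_abs_linear.
by apply/funext => x; rewrite mul1r !mul0r !addr0 add0r.
Qed.

Lemma lebesgue_measure_abs (c rho : R) : lebesgue_measure [set z : mR | `|z - c| = rho] = 0%E.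
Proof.
apply: countable_lebesgue_measure0; apply: (@sub_countable _ _ _ [set c + rho; c - rho]).
  apply: subset_card_le => z /=; case: (lerP 0 (z - c)) => h.
    by rewrite ger0_norm// => <-; left; ring.
  by rewrite ltr0_norm// => <-; right; ring.
exact/finite_set_countable/finite_set2.
Qed.

(** On the zero level one of the three terms of the maximum equals rho. For the first two this is a
    product with a null factor; for [v] the vertical sections are countable and Tonelli applies. *)
Lemma vol3_box_with_null c rho v : measurable_fun setT v ->
  (forall x1 x2, countable [set z | v (x1, x2, z) = rho]) ->
  vol3 [set x | box_with c rho v x = 0] = 0%E.
Proof.
move=> mv cv.
have mset (f : T -> R) : measurable_fun setT f -> measurable [set x | f x = rho].
  move=> mf; rewrite (_ : [set x | _] = setT `&` f @^-1` [set rho]) ?setTI//.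
  by rewrite -[X in measurable X]setTI; exact: mf.
have n1 (A : set mR) : A = [set z : mR | `|z - c| = rho] ->
    measurable A /\ lebesgue_measure A = 0%E.
  move=> ->; split; last exact: lebesgue_measure_abs.
  rewrite (_ : [set z | _] = setT `&` (fun z : mR => `|z - c|) @^-1` [set rho]) ?setTI//.
  rewrite -[X in measurable X]setTI.
  suff : measurable_fun setT (fun z : mR => `|z - c|) by exact.
  by apply: measurableT_comp => //; exact: measurable_funB.
have [mA vA] := n1 _ erefl.
pose A1 : set T := [set z : mR | `|z - c| = rho] `*` setT `*` setT.
pose A2 : set T := setT `*` [set z : mR | `|z - c| = rho] `*` setT.
pose A3 : set T := [set x | v x = rho].
have mA1 : measurable A1 by do 2 (apply: measurableX => //).
have mA2 : measurable A2 by do 2 (apply: measurableX => //).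
have mA3 : measurable A3 by exact: mset.
have v1 : vol3 A1 = 0%E.
  by rewrite vol3_box// -[X in (_ * X * _)%E]/(lebesgue_measure setT) vA !mul0e.
have v2 : vol3 A2 = 0%E by rewrite vol3_box// vA mule0 mul0e.
have v3 : vol3 A3 = 0%E.
  by apply: vol3_null => x1 x2; exact/countable_lebesgue_measure0/cv.
have mbox : measurable [set x | box_with c rho v x = 0].
  rewrite (_ : [set x | _] = setT `&` box_with c rho v @^-1` [set 0]) ?setTI//.
  rewrite -[X in measurable X]setTI.
  suff : measurable_fun setT (box_with c rho v) by exact.
  exact: measurable_box_with.
apply: (@subset_measure0 _ _ _ vol3 _ (A1 `|` A2 `|` A3)) => //.
- by apply: measurableU => //; exact: measurableU.
- move=> x /= /eqP; rewrite /box_with subr_eq0.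
  case: (leP (Num.max `|x.1.1 - c| `|x.1.2 - c|) (v x)) => _ /eqP; first by right.
  by case: leP => _ h; left; [right|left]; split => //; split.
- have mA12 : measurable (A1 `|` A2) by exact: measurableU.
  apply: (etrans (@measureU0 _ _ _ vol3 _ _ mA12 mA3 v3)).
  exact: (etrans (@measureU0 _ _ _ vol3 _ _ mA1 mA2 v2)).
Qed.
End Boxes.

(** * The constant of proportionality as a function of the slope *)

Section Kappa.
Variable R : realType.
Local Notation mR := (measurableTypeR R).
Local Notation T := (mR * mR * mR)%type.
Implicit Types (m p : T).

Definition density m : R := fine (lift_vol m (hcube (zero3 R) 1)).

Lemma densityE m : lift_vol m (hcube (zero3 R) 1) = (density m)%:E.
Proof.
rewrite /density fineK// ge0_fin_numE; last exact: hausdorff3_ge0.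
apply: (le_lt_trans (lift_vol_le_flat _ _)).
rewrite lte_mul_pinfty ?lee_fin ?exprn_ge0//; first by rewrite !addr_ge0// sqr_ge0.
exact: lift_vol_flat_fin.
Qed.

Lemma lift_vol_hcube m p (w : R) : 0 < w -> lift_vol m (hcube p w) = (density m * w ^+ 3)%:E.
Proof. by move=> w0; rewrite lift_vol_hcube_affine// densityE -EFinM mulrC. Qed.

Lemma density_flat_gt0 : 0 < density (zero3 R).
Proof. by rewrite -lte_fin -densityE lift_vol_flat_gt0. Qed.

Lemma lift_vol_box_with m (c rho : R) (v : T -> R) (K M : R) : measurable_fun setT v -> 0 <= K -> lip K v ->
  (forall x1 x2, countable [set z : R | v (x1, x2, z) = rho]) ->
  (forall x, box_with c rho v x <= 0 -> [/\ `|x.1.1| <= M, `|x.1.2| <= M & `|x.2| <= M]) ->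
  lift_vol m [set x | box_with c rho v x <= 0] =
  ((density m)%:E * vol3 [set x | (box_with c rho v x <= 0)%R])%E.
Proof.
move=> mv K0 vK cv bM.
(* The enclosing cube is half-open, so its side needs a margin beyond M. *)
pose L := `|M| + 1; have L0 : 0 < L by rewrite ltr_wpDl.
apply: (@proportional_sublevel _ _ _ _ _ _ _ _ (1 + K) (- L, - L, - L) (L + L)).
- exact: lift_vol_le.
- exact: lift_volU.
- exact: lift_vol0.
- exact: lift_vol_hcube.
- exact: measurable_box_with.
- by rewrite addr_ge0.
- exact: lip_box_with.
- by rewrite addr_gt0.
- have ML : M < L by rewrite /L (le_lt_trans (ler_norm _))// ltrDl.
  have E (t : R) : `|t| <= M -> - L <= t < - L + (L + L).
    by rewrite ler_norml => /andP[? ?]; apply/andP; split; lra.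
  by move=> x /= /bM[h1 h2 h3]; apply/hcubeP; split; exact: E.
- exact: vol3_box_with_null.
Qed.

Lemma hausdorff3_isometry n (f g : 'rV[R]_n -> 'rV[R]_n) U :
  (forall x y, enorm (f x - f y) = enorm (x - y)) ->
  (forall x y, enorm (g x - g y) = enorm (x - y)) -> (forall x, U x -> g (f x) = x) ->
  hausdorff3 (f @` U) = hausdorff3 U.
Proof.
move=> fi gi fg; apply/eqP; rewrite eq_le; apply/andP; split.
  rewrite -[leRHS]mul1e -[X in X%:E](expr1n _ 3).
  by apply: hausdorff3_image => // x y; rewrite fi mul1r.
rewrite [in leLHS](_ : U = g @` (f @` U)).
  rewrite -[leRHS]mul1e -[X in X%:E](expr1n _ 3).
  by apply: hausdorff3_image => // x y; rewrite gi mul1r.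
apply/seteqP; split=> [x Ux|_ [_ [x Ux <-] <-]]; last by rewrite fg.
by exists (f x); [exists x|exact: fg].
Qed.

Lemma eq_enorm n (x y : 'rV[R]_n) : dotp x x = dotp y y -> enorm x = enorm y.
Proof. by rewrite /enorm => ->. Qed.

(* Rotation by the angle of slope [t] in the plane of the last two coordinates. *)
Definition rot34 (t : R) (x : 'rV[R]_4) : 'rV[R]_4 :=
  let r := Num.sqrt (1 + t ^+ 2) in
  vec4 (co x 0) (co x 1) ((co x 2 - t * co x 3) / r) ((t * co x 2 + co x 3) / r).

Lemma sqrt1D_gt0 (t : R) : 0 < Num.sqrt (1 + t ^+ 2).
Proof. by rewrite sqrtr_gt0 ltr_wpDr// sqr_ge0. Qed.

Lemma sqr_sqrt1D (t : R) : Num.sqrt (1 + t ^+ 2) ^+ 2 = 1 + t ^+ 2.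
Proof. by rewrite sqr_sqrtr// addr_ge0// sqr_ge0. Qed.

Lemma rot34_isometry t x y : enorm (rot34 t x - rot34 t y) = enorm (x - y).
Proof.
apply: eq_enorm; rewrite !dotpE !coB /rot34.
set r := Num.sqrt _; have r0 : r != 0 by rewrite gt_eqF ?sqrt1D_gt0.
have rE : r ^+ 2 = 1 + t ^+ 2 by exact: sqr_sqrt1D.
have [-> -> -> ->] := co_vec4 (co x 0) (co x 1) ((co x 2 - t * co x 3) / r) ((t * co x 2 + co x 3) / r).
have [-> -> -> ->] := co_vec4 (co y 0) (co y 1) ((co y 2 - t * co y 3) / r) ((t * co y 2 + co y 3) / r).
set u := co x 2 - co y 2; set w := co x 3 - co y 3.
have -> : (co x 2 - t * co x 3) / r - (co y 2 - t * co y 3) / r = (u - t * w) / r.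
  by rewrite /u /w; field.
have -> : (t * co x 2 + co x 3) / r - (t * co y 2 + co y 3) / r = (t * u + w) / r.
  by rewrite /u /w; field.
rewrite -[LHS]addrA -[RHS]addrA; congr (_ + _).
transitivity (((u - t * w) ^+ 2 + (t * u + w) ^+ 2) / r ^+ 2); first by field.
rewrite rE; field; rewrite -rE; exact: expf_neq0.
Qed.

Lemma rot34K t x : rot34 (- t) (rot34 t x) = x.
Proof.
rewrite {1}/rot34 sqrrN; set r := Num.sqrt _; have r0 : r != 0 by rewrite gt_eqF ?sqrt1D_gt0.
have rE : r ^+ 2 = 1 + t ^+ 2 by exact: sqr_sqrt1D.
rewrite /rot34 -/r.
have [-> -> -> ->] := co_vec4 (co x 0) (co x 1) ((co x 2 - t * co x 3) / r) ((t * co x 2 + co x 3) / r).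
have tn : 1 + t ^+ 2 != 0 by rewrite -rE expf_neq0.
set a := (X in vec4 _ _ X _); set b := (X in vec4 _ _ _ X).
have [e0 e1 e2 e3] := co_vec4 (co x 0) (co x 1) a b.
apply: co_inj; rewrite ?e0 ?e1 ?e2 ?e3//.
  rewrite /a; transitivity (co x 2 * (1 + t ^+ 2) / r ^+ 2); first by field.
  by rewrite rE; field.
rewrite /b; transitivity (co x 3 * (1 + t ^+ 2) / r ^+ 2); first by field.
by rewrite rE; field.
Qed.

Lemma lebesgue_measure_slab (al be rho : R) : 0 < al -> 0 <= rho ->
  lebesgue_measure [set z : mR | `|al * z + be| <= rho] = (2 * rho / al)%:E.
Proof.
move=> al0 rho0.
rewrite (_ : [set z | _] = `[(- rho - be) / al, (rho - be) / al]%classic).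
  rewrite lebesgue_measure_itv /= lte_fin; case: ltP => h.
    by rewrite -EFinB; congr (_%:E); field; rewrite gt_eqF.
  congr (_%:E); have : rho - be <= - rho - be.
    by move: h; rewrite ler_pM2r// invr_gt0.
  move=> ?; have -> : rho = 0 by lra.
  by rewrite mulr0 mul0r.
apply/seteqP; split => z /=; rewrite in_itv /= ler_norml ler_pdivrMr// ler_pdivlMr// mulrC;
  by move=> /andP[? ?]; apply/andP; split; lra.
Qed.

Lemma integral_square_cst (a b k : R) : a <= b -> 0 <= k ->
  (\int[lebesgue_measure]_(x in `[a, b]) \int[lebesgue_measure]_(y in `[a, b]) k%:E)%E =
  (k * (b - a) ^+ 2)%:E.
Proof.
move=> ab k0.
have mab : lebesgue_measure (`[a, b]%classic : set mR) = (b - a)%:E.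
  rewrite lebesgue_measure_itv /= lte_fin; case: ltP => h; first by rewrite -EFinB.
  by congr (_%:E); apply/eqP; rewrite eq_sym subr_eq0 eq_le ab h.
have ic (c : \bar R) :
    (\int[@lebesgue_measure R]_(_ in `[a, b]) c = c * (b - a)%:E)%E.
  by rewrite -mab; exact: integral_cst.
under eq_integral do rewrite ic.
by rewrite ic -!EFinM; congr (_%:E); ring.
Qed.

Lemma countable_abs_affine (al be rho : R) : al != 0 ->
  countable [set z : R | `|al * z + be| = rho].
Proof.
move=> al0; apply: (@sub_countable _ _ _ [set (rho - be) / al; (- rho - be) / al]).
  apply: subset_card_le => z /=; case: (lerP 0 (al * z + be)) => h.
    by rewrite ger0_norm// => <-; left; field.
  by rewrite ltr0_norm// => <-; right; field.
exact/finite_set_countable/finite_set2.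
Qed.

Definition absform (a1 a2 a3 be : R) (x : T) : R :=
  `|a1 * x.1.1 + a2 * x.1.2 + a3 * x.2 + be|.

Lemma absformE a1 a2 a3 be (x : T) :
  absform a1 a2 a3 be x = `|a3 * x.2 + (a1 * x.1.1 + a2 * x.1.2 + be)|.
Proof. by rewrite /absform; congr `|_|; ring. Qed.

Section Slab.
Variables (c rho a1 a2 a3 be : R).
Hypothesis a30 : 0 < a3.
Hypothesis rho0 : 0 <= rho.
Let v := absform a1 a2 a3 be.

Lemma slab_countable x1 x2 : countable [set z : R | v (x1, x2, z) = rho].
Proof.
have a3n : a3 != 0 by rewrite gt_eqF.
have := @countable_abs_affine a3 (a1 * x1 + a2 * x2 + be) rho a3n.
by congr (countable _); apply/seteqP; split => z; rewrite /v /= absformE.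
Qed.

(** A sheared box: a1, a2 and be only translate the vertical chords, all of length 2 * rho / a3. *)
Lemma vol3_slab : vol3 [set x | box_with c rho v x <= 0] =
  (2 * rho / a3 * (2 * rho) ^+ 2)%:E.
Proof.
have mv : measurable_fun setT v by exact: measurable_abs_linear.
rewrite (@vol3_iter _ _ (fun _ _ => 2 * rho / a3) (c - rho) (c + rho)).
- rewrite integral_square_cst//; first by congr (_%:E); ring.
    by rewrite lerD2l (@le_trans _ _ 0)// oppr_le0.
  by rewrite divr_ge0 ?mulr_ge0// ltW.
- by apply: measurable_sublevel; exact: measurable_box_with.
- move=> x1 x2 h1 h2; rewrite -(@lebesgue_measure_slab a3 (a1 * x1 + a2 * x2 + be))//.
  congr (lebesgue_measure _); apply/seteqP; split => z;
    by rewrite /= box_with_le0 /= h1 h2 /= /v absformE.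
- by move=> x1 x2 z /=; rewrite box_with_le0 => /and3P[].
Qed.

Lemma lift_vol_slab m : lift_vol m [set x | box_with c rho v x <= 0] =
  (density m * (2 * rho / a3 * (2 * rho) ^+ 2))%:E.
Proof.
pose N := `|c| + rho; pose D := rho + `|a1| * N + `|a2| * N + `|be|.
have N0 : 0 <= N by rewrite addr_ge0.
have D0 : 0 <= D by rewrite !addr_ge0// mulr_ge0.
rewrite (@lift_vol_box_with _ _ _ _ (`|a1| + `|a2| + `|a3|) (N + D / a3)).
- by rewrite vol3_slab -EFinM.
- exact: measurable_abs_linear.
- by rewrite !addr_ge0.
- exact: lip_abs_linear.
- exact: slab_countable.
move=> x; rewrite box_with_le0 /v /absform => /and3P[h1 h2 h3].
have E (t : R) : c - rho <= t <= c + rho -> `|t| <= N.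
  move=> /andP[? ?]; have := ler_norm c; have := ler_norm (- c); rewrite normrN => ? ?.
  by rewrite ler_norml /N; apply/andP; split; lra.
have n1 := E _ h1; have n2 := E _ h2.
split; rewrite ?(le_trans n1) ?(le_trans n2) ?lerDl ?divr_ge0// ?(ltW a30)//.
rewrite (@le_trans _ _ (D / a3))// ?lerDr//.
rewrite ler_pdivlMr// -{1}(gtr0_norm a30) -normrM.
have -> : x.2 * a3 = (a1 * x.1.1 + a2 * x.1.2 + a3 * x.2 + be) - a1 * x.1.1 - a2 * x.1.2 - be.
  by ring.
apply: le_trans (ler_normB _ _) _; rewrite lerD2r.
apply: le_trans (ler_normB _ _) _; rewrite lerD//; last by rewrite normrM ler_wpM2l.
by apply: le_trans (ler_normB _ _) _; rewrite lerD// normrM ler_wpM2l.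
Qed.
End Slab.

(** The rotation [rot34 m.2] sends the normal (m1, m2, m3, 1) to (m1, m2, 0, r), and these are the
    slopes of the rotated hyperplane. *)
Definition rot_slope (m : T) : T :=
  let r := Num.sqrt (1 + m.2 ^+ 2) in ((m.1.1 / r, m.1.2 / r), 0).

(* [rot34] induces on space a linear map with volume factor [sqrt (1 + m3 ^ 2)],
   which is evaluated on the unit cube. *)
Lemma density_rot m : density m = Num.sqrt (1 + m.2 ^+ 2) * density (rot_slope m).
Proof.
case: m => [[a b] t]; rewrite /rot_slope /=.
set r := Num.sqrt _; have r0 : 0 < r by exact: sqrt1D_gt0.
have rn : r != 0 by rewrite gt_eqF.
have rE : r ^+ 2 = 1 + t ^+ 2 by exact: sqr_sqrt1D.
(* [E0] is the closed unit cube and [E1] its image under the map [psi] introduced below, since [v1]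
   is [v0] composed with the inverse of [psi]. Being a slab with leading coefficient 1 / r, [E1] has
   volume r. *)
pose v0 : T -> R := absform 0 0 1 (- (1 / 2)).
pose v1 : T -> R := absform (- t * a / r ^+ 2) (- t * b / r ^+ 2) r^-1 (- (1 / 2)).
set E0 := [set x : T | box_with (1 / 2) (1 / 2) v0 x <= 0].
set E1 := [set x : T | box_with (1 / 2) (1 / 2) v1 x <= 0].
have P0 : lift_vol (a, b, t) E0 = (density (a, b, t))%:E.
  by rewrite lift_vol_slab//; congr (_%:E); field.
have P1 : lift_vol (a / r, b / r, 0) E1 = (density (a / r, b / r, 0) * r)%:E.
  by rewrite lift_vol_slab ?invr_gt0//; congr (_%:E); field.
suff PP : lift_vol (a / r, b / r, 0) E1 = lift_vol (a, b, t) E0.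
  by move: PP; rewrite P0 P1 => -[<-]; rewrite mulrC.
rewrite /lift_vol -(@hausdorff3_isometry _ (rot34 t) (rot34 (- t)) (lift (a, b, t) @` E0)).
- congr hausdorff3; rewrite image_comp.
  pose psi (p : T) : T := ((p.1.1, p.1.2), r * p.2 + t / r * (a * p.1.1 + b * p.1.2)).
  have lpsi p : lift (a / r, b / r, 0) (psi p) = rot34 t (lift (a, b, t) p).
    rewrite /rot34 -/r; have [-> -> -> ->] := co_lift (a, b, t) p.
    rewrite {1}/lift /=; congr (vec4 _ _ _ _).
      apply: (mulIf rn); rewrite divfK// mulrDl mulrAC -expr2 rE; field.
      by [].
    by field.
  have vpsi p : v1 (psi p) = v0 p.
    by rewrite /v1 /v0 /absform /psi /=; congr `|_|; field.
  have Epsi p : E1 (psi p) = E0 p.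
    by rewrite /E1 /E0 /= !box_with_le0 vpsi.
  apply/seteqP; split => [_ [q Eq <-]|_ [p Ep <-]] /=; last first.
    by rewrite -lpsi; exists (psi p) => //; rewrite Epsi.
  pose p : T := ((q.1.1, q.1.2), (q.2 - t / r * (a * q.1.1 + b * q.1.2)) / r).
  have qE : q = psi p.
    rewrite /psi /p /= [LHS](_ : q = ((q.1.1, q.1.2), q.2)); last by case: (q) => [[]].
    by congr (_, _, _); field.
  by exists p; [rewrite -Epsi -qE|rewrite -lpsi -qE].
- exact: rot34_isometry.
- exact: rot34_isometry.
- by move=> x _; exact: rot34K.
Qed.

Definition swap23 (x : 'rV[R]_4) : 'rV[R]_4 := vec4 (co x 0) (co x 2) (co x 1) (co x 3).
Definition swap12 (x : 'rV[R]_4) : 'rV[R]_4 := vec4 (co x 1) (co x 0) (co x 2) (co x 3).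

Lemma density_perm (f : 'rV[R]_4 -> 'rV[R]_4) (g : T -> T) m m' :
  (forall x y, enorm (f x - f y) = enorm (x - y)) -> (forall x, f (f x) = x) ->
  (forall p, g (g p) = p) ->
  (forall p, hcube (zero3 R) 1 p -> hcube (zero3 R) 1 (g p)) ->
  (forall p, f (lift m p) = lift m' (g p)) -> density m' = density m.
Proof.
move=> fi ff gg gQ fg; rewrite /density /lift_vol; congr fine.
rewrite -(@hausdorff3_isometry _ f f (lift m @` _) fi fi) => [|x _]; last exact: ff.
congr hausdorff3; rewrite image_comp; apply/seteqP; split=> _ [p Qp <-] /=.
  by exists (g p); [exact: gQ|rewrite /= fg gg].
by exists (g p); [exact: gQ|rewrite -fg].
Qed.

Lemma density_swap23 a b t : density (a, b, t) = density (a, t, b).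
Proof.
apply: (@density_perm swap23 (fun p => (p.1.1, p.2, p.1.2))).
- move=> x y; apply: eq_enorm; rewrite !dotpE !coB.
  have [-> -> -> ->] := co_vec4 (co x 0) (co x 2) (co x 1) (co x 3).
  by have [-> -> -> ->] := co_vec4 (co y 0) (co y 2) (co y 1) (co y 3); ring.
- move=> x; rewrite {1}/swap23.
  have [-> -> -> ->] := co_vec4 (co x 0) (co x 2) (co x 1) (co x 3).
  by have [? ? ? ?] := co_vec4 (co x 0) (co x 1) (co x 2) (co x 3); apply: co_inj.
- by case=> [[]].
- by move=> p /hcubeP[? ? ?]; apply/hcubeP.
- move=> p; rewrite /swap23; have [-> -> -> ->] := co_lift (a, t, b) p.
  by rewrite /lift /=; congr vec4; ring.
Qed.

Lemma density_swap12 a b t : density (a, b, t) = density (b, a, t).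
Proof.
apply: (@density_perm swap12 (fun p => (p.1.2, p.1.1, p.2))).
- move=> x y; apply: eq_enorm; rewrite !dotpE !coB.
  have [-> -> -> ->] := co_vec4 (co x 1) (co x 0) (co x 2) (co x 3).
  by have [-> -> -> ->] := co_vec4 (co y 1) (co y 0) (co y 2) (co y 3); ring.
- move=> x; rewrite {1}/swap12.
  have [-> -> -> ->] := co_vec4 (co x 1) (co x 0) (co x 2) (co x 3).
  by have [? ? ? ?] := co_vec4 (co x 0) (co x 1) (co x 2) (co x 3); apply: co_inj.
- by case=> [[]].
- by move=> p /hcubeP[? ? ?]; apply/hcubeP.
- move=> p; rewrite /swap12; have [-> -> -> ->] := co_lift (b, a, t) p.
  by rewrite /lift /=; congr vec4; ring.
Qed.

(** Three rotations, with coordinate swaps in between, annihilate the slopes one at a time. The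
    product of the three factors r, r' and sqrt (1 + (a / (r r')) ^ 2) telescopes. *)
Lemma density_norm m : density m =
  Num.sqrt (1 + m.1.1 ^+ 2 + m.1.2 ^+ 2 + m.2 ^+ 2) * density (zero3 R).
Proof.
case: m => [[a b] t] /=; rewrite density_rot /rot_slope /=.
set r := Num.sqrt (1 + t ^+ 2); have r0 : 0 < r by exact: sqrt1D_gt0.
rewrite density_swap23 density_rot /rot_slope /= mul0r.
set r' := Num.sqrt (1 + _); have r'0 : 0 < r' by exact: sqrt1D_gt0.
rewrite density_swap12 density_swap23 density_rot /rot_slope /= !mul0r !mulrA.
rewrite -!sqrtrM ?addr_ge0// ?sqr_ge0//; last by rewrite mulr_ge0// addr_ge0// sqr_ge0.
congr (Num.sqrt _ * _).
have rE : r ^+ 2 = 1 + t ^+ 2 by exact: sqr_sqrt1D.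
have r'E : r' ^+ 2 = 1 + (b / r) ^+ 2 by exact: sqr_sqrt1D.
rewrite -r'E -rE !exprMn !exprVn.
transitivity (r ^+ 2 * r' ^+ 2 + a ^+ 2); first by field; rewrite !gt_eqF.
rewrite r'E; transitivity (r ^+ 2 + b ^+ 2 + a ^+ 2); first by field; rewrite gt_eqF.
by rewrite rE; ring.
Qed.
End Kappa.

(** * Positive parts and their primitives *)

Section Primitives.
Variable R : realType.
Implicit Types (x e k : R).

Definition pos x : R := Num.max x 0.

Lemma posP x : (0 <= x /\ pos x = x) \/ (x <= 0 /\ pos x = 0).
Proof. by rewrite /pos; case: (leP x 0) => h; [right|left; rewrite ltW]. Qed.

Lemma pos_ge0 x : 0 <= pos x.
Proof. by rewrite le_max lexx orbT. Qed.

(** A remainder estimate differentiates powers of positive parts uniformly, including at the point 0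
    where their formula changes. *)
Lemma is_derive_quadratic_bound (F : R -> R) (x l C : R) :
  (forall h, `|h| <= 1 -> `|F (x + h) - F x - l * h| <= C * h ^+ 2) ->
  is_derive x 1 F l.
Proof.
move=> FC.
suff cv : (h^-1 *: (F (h *: 1 + x) - F x)) @[h --> 0^'] --> l.
  by apply: DeriveDef; [apply: cvgP cv|exact: cvg_lim cv].
apply/cvgrPdist_le => /= eps eps0.
pose d := Num.min 1 (eps / (`|C| + 1)).
have C1 : 0 < `|C| + 1 by rewrite ltr_wpDl.
have d0 : 0 < d by rewrite lt_min ltr01 divr_gt0.
exists d => //= h /=; rewrite sub0r normrN => hd h0.
have hd1 : `|h| <= 1 by rewrite (le_trans (ltW hd))// ge_min lexx.
have hd2 : `|h| <= eps / (`|C| + 1) by rewrite (le_trans (ltW hd))// ge_min lexx orbT.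
have -> : l - h^-1 *: (F (h *: 1 + x) - F x) = - (h^-1 * (F (x + h) - F x - l * h)).
  rewrite -[h *: 1]/(h * 1) -[_ *: _]/(_ * _) mulr1 (addrC h); field => //.
rewrite normrN normrM normfV ler_pdivrMl ?normr_gt0//.
apply: (le_trans (FC _ hd1)).
apply: (@le_trans _ _ ((`|C| + 1) * h ^+ 2)).
  by rewrite ler_wpM2r ?sqr_ge0// (le_trans (ler_norm _))// lerDl.
rewrite -real_normK ?num_real// expr2 mulrCA ler_wpM2l//.
by rewrite mulrC -ler_pdivlMr.
Qed.

Lemma pos2_bound x h : `|pos (x + h) ^+ 2 - pos x ^+ 2 - 2 * pos x * h| <= h ^+ 2.
Proof.
rewrite ler_norml; apply/andP.
have h2 := sqr_ge0 h; have xh2 := sqr_ge0 (x + h).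
case: (posP (x + h)) => -[p ->]; case: (posP x) => -[q ->].
- have -> : (x + h) ^+ 2 - x ^+ 2 - 2 * x * h = h ^+ 2 by ring.
  by split; lra.
- have q1 : 0 <= - x * (x + h) by rewrite mulr_ge0// oppr_ge0.
  have q2 : 0 <= - x * h by rewrite mulr_ge0 ?oppr_ge0//; lra.
  have e1 : (x + h) ^+ 2 - 0 ^+ 2 - 2 * 0 * h = h ^+ 2 - (- x * (x + h)) - (- x * h) by ring.
  have e2 : (x + h) ^+ 2 - 0 ^+ 2 - 2 * 0 * h = (x + h) ^+ 2 by ring.
  by split; [rewrite e2|rewrite e1]; lra.
- have q1 : 0 <= x * - (x + h) by rewrite mulr_ge0// oppr_ge0.
  have q2 : 0 <= x ^+ 2 by exact: sqr_ge0.
  have e1 : 0 ^+ 2 - x ^+ 2 - 2 * x * h = h ^+ 2 - (x + h) ^+ 2 by ring.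
  have e2 : 0 ^+ 2 - x ^+ 2 - 2 * x * h = x ^+ 2 + 2 * (x * - (x + h)) by ring.
  by split; [rewrite e2|rewrite e1]; lra.
- have -> : 0 ^+ 2 - 0 ^+ 2 - 2 * 0 * h = 0 :> R by ring.
  by split; lra.
Qed.

Lemma pos3_bound x h : `|h| <= 1 ->
  `|pos (x + h) ^+ 3 - pos x ^+ 3 - 3 * pos x ^+ 2 * h| <= (3 * `|x| + 1) * h ^+ 2.
Proof.
rewrite ler_norml => /andP[l u]; rewrite ler_norml; apply/andP.
have h2 := sqr_ge0 h; have xh2 := sqr_ge0 (x + h); have x2 := sqr_ge0 x.
case: (posP (x + h)) => -[p ->]; case: (posP x) => -[q ->].
- rewrite (ger0_norm q).
  have -> : (x + h) ^+ 3 - x ^+ 3 - 3 * x ^+ 2 * h = (3 * x + h) * h ^+ 2 by ring.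
  by split; rewrite -?mulNr ler_wpM2r//; lra.
- rewrite (ler0_norm q).
  have -> : (x + h) ^+ 3 - 0 ^+ 3 - 3 * 0 ^+ 2 * h = (x + h) * (x + h) ^+ 2 by ring.
  have q1 : (x + h) * (x + h) ^+ 2 <= 1 * h ^+ 2.
    by rewrite ler_pM//; [lra|rewrite lerXn2r ?nnegrE//; lra].
  have q2 : 0 <= (x + h) * (x + h) ^+ 2 by rewrite mulr_ge0.
  have q3 : 0 <= - x * h ^+ 2 by rewrite mulr_ge0 ?oppr_ge0.
  have -> : (3 * - x + 1) * h ^+ 2 = 3 * (- x * h ^+ 2) + h ^+ 2 by ring.
  by split; lra.
- rewrite (ger0_norm q).
  have q1 : 0 <= x ^+ 2 * (- x - 3 * h) by rewrite mulr_ge0//; lra.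
  have q2 : 0 <= x * (- h * (- h - x)) by do 2 (rewrite mulr_ge0//; try lra).
  have q3 : 0 <= x ^+ 2 * x by rewrite mulr_ge0.
  have q4 : 0 <= x * h ^+ 2 by rewrite mulr_ge0.
  have -> : 0 ^+ 3 - x ^+ 3 - 3 * x ^+ 2 * h = x ^+ 2 * (- x - 3 * h) by ring.
  have e : x ^+ 2 * (- x - 3 * h) = 3 * (x * h ^+ 2) - 3 * (x * (- h * (- h - x))) - x ^+ 2 * x.
    by ring.
  have -> : (3 * x + 1) * h ^+ 2 = 3 * (x * h ^+ 2) + h ^+ 2 by ring.
  by split; lra.
- have -> : 0 ^+ 3 - 0 ^+ 3 - 3 * 0 ^+ 2 * h = 0 :> R by ring.
  have : 0 <= (3 * `|x| + 1) * h ^+ 2 by rewrite mulr_ge0// addr_ge0// mulr_ge0.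
  by split; lra.
Qed.

Lemma is_derive_pos2 x : is_derive x 1 (fun x => pos x ^+ 2) (2 * pos x).
Proof.
by apply: (@is_derive_quadratic_bound _ _ _ 1) => h _; rewrite mul1r pos2_bound.
Qed.

Lemma is_derive_pos3 x : is_derive x 1 (fun x => pos x ^+ 3) (3 * pos x ^+ 2).
Proof. by apply: is_derive_quadratic_bound => h; exact: pos3_bound. Qed.

Lemma continuous_pos : continuous pos.
Proof.
by move=> x; apply: continuous_max; [exact: cvg_id|exact: cvg_cst].
Qed.

Definition primitive (f F : R -> R) :=
  continuous f /\ forall x, is_derive x 1 F (f x).

Lemma primitiveD f F g G : primitive f F -> primitive g G ->
  primitive (fun x => f x + g x) (fun x => F x + G x).
Proof.
move=> [cf fF] [cg gG]; split=> x; first by apply: cvgD; [exact: cf|exact: cg].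
exact: is_deriveD.
Qed.

Lemma primitiveZ c f F : primitive f F -> primitive (fun x => c * f x) (fun x => c * F x).
Proof.
move=> [cf fF]; split=> x; first by apply: cvgM; [exact: cvg_cst|exact: cf].
exact: is_deriveZ.
Qed.

Lemma primitive_affine f F e k : k != 0 -> primitive f F ->
  primitive (fun x => f (e + k * x)) (fun x => F (e + k * x) / k).
Proof.
move=> k0 [cf fF].
have ca : continuous (fun x => e + k * x).
  by move=> x; apply: cvgD; [exact: cvg_cst|apply: cvgM; [exact: cvg_cst|exact: cvg_id]].
split => x; first by apply: (continuous_comp (ca x)); exact: cf.
have aff : is_derive x 1 (fun y => e + k * y) k.
  rewrite (_ : (fun y => _) = cst e \+ k \*: id)//.
  by apply: is_derive_eq; rewrite add0r -[_ *: _]/(k * 1) mulr1.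
have := @is_deriveZ _ _ _ (fun y => F (e + k * y)) k^-1 x 1 (f (e + k * x) * k) _.
rewrite -[_ *: _]/(_ * _) mulrCA mulVf// mulr1 => H.
rewrite (_ : (fun y => F (e + k * y) / k) = k^-1 \*: (fun y => F (e + k * y))).
  by apply: H; exact: (@is_derive1_comp _ F (fun y => e + k * y)).
by apply/funext => y; rewrite mulrC.
Qed.

Lemma primitive_cst c : primitive (fun=> c) (fun x => c * x).
Proof.
split => x; first exact: cvg_cst.
rewrite (_ : (fun x => c * x) = c \*: id)//.
by apply: is_derive_eq; rewrite -[_ *: _]/(c * 1) mulr1.
Qed.

Lemma integral_primitive f F a b : a < b -> primitive f F ->
  (\int[lebesgue_measure]_(x in `[a, b]) (f x)%:E = (F b - F a)%:E)%E.
Proof.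
move=> ab [cf fF]; rewrite (@continuous_FTC2 _ f F)//.
- by apply: continuous_subspaceT => x; exact: cf.
- split.
  + by move=> x _; have [] := fF x.
  + by apply: cvg_at_right_filter; apply: differentiable_continuous; apply/derivable1_diffP; have [] := fF a.
  + by apply: cvg_at_left_filter; apply: differentiable_continuous; apply/derivable1_diffP; have [] := fF b.
- by move=> x _; rewrite derive1E; have [_ ->] := fF x.
Qed.

(* [v] is the integral of [f] over [-1, 1], certified by a primitive. *)
Definition prim_int f v := exists2 F, primitive f F & F 1 - F (- 1) = v.

Lemma prim_intD f g v w : prim_int f v -> prim_int g w ->
  prim_int (fun x => f x + g x) (v + w).
Proof.
move=> [F fF <-] [G gG <-]; exists (fun x => F x + G x); first exact: primitiveD.
by ring.
Qed.

Lemma prim_intZ c f v : prim_int f v -> prim_int (fun x => c * f x) (c * v).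
Proof.
move=> [F fF <-]; exists (fun x => c * F x); first exact: primitiveZ.
by rewrite mulrBr.
Qed.

Lemma prim_int_integral f v : prim_int f v ->
  (\int[lebesgue_measure]_(x in `[(- 1)%R, 1%R]) (f x)%:E = v%:E)%E.
Proof. by move=> [F fF <-]; apply: integral_primitive => //; lra. Qed.

Lemma continuous_pos2 : continuous (fun x => pos x ^+ 2).
Proof.
move=> x; apply: differentiable_continuous; apply/derivable1_diffP.
by have [] := is_derive_pos2 x.
Qed.

Lemma prim_int_pos1 e k : k != 0 -> prim_int (fun y => pos (e + k * y))
  ((pos (e + k) ^+ 2 - pos (e - k) ^+ 2) / (2 * k)).
Proof.
move=> k0.
have p : primitive pos (fun x => 2^-1 * pos x ^+ 2).
  split=> [|x]; first exact: continuous_pos.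
  have := @is_deriveZ _ _ _ (fun x => pos x ^+ 2) 2^-1 x 1 _ (is_derive_pos2 x).
  by rewrite -[_ *: _]/(_ * _) mulKf.
exists (fun x => 2^-1 * pos (e + k * x) ^+ 2 / k); first exact: (primitive_affine e k0 p).
by rewrite mulr1 mulrN1; field.
Qed.

(** The integral of pos (t + u * x) ^ 2 over [-1, 1]. The value u = 0 needs its own clause because
    the quotient degenerates there, and it does occur: u will be the smallest coordinate. *)
Definition posint2 (t u : R) : R :=
  if u == 0 then 2 * pos t ^+ 2 else (pos (t + u) ^+ 3 - pos (t - u) ^+ 3) / (3 * u).

Lemma prim_int_pos2 t u : prim_int (fun x => pos (t + u * x) ^+ 2) (posint2 t u).
Proof.
rewrite /posint2; case: eqVneq => [->|u0].
  exists (fun x => pos t ^+ 2 * x); last by ring.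
  under eq_fun do rewrite mul0r addr0; exact: primitive_cst.
have p : primitive (fun x => pos x ^+ 2) (fun x => 3^-1 * pos x ^+ 3).
  split=> [|x]; first exact: continuous_pos2.
  have := @is_deriveZ _ _ _ (fun x => pos x ^+ 3) 3^-1 x 1 _ (is_derive_pos3 x).
  by rewrite -[_ *: _]/(_ * _) mulKf.
exists (fun x => 3^-1 * pos (t + u * x) ^+ 3 / u); first exact: (primitive_affine t u0 p).
by rewrite mulr1 mulrN1; field.
Qed.

Lemma posint2N t u : posint2 t (- u) = posint2 t u.
Proof.
rewrite /posint2 oppr_eq0; case: eqP => // /eqP u0.
by rewrite opprK mulrN invrN mulrN -mulNr opprB.
Qed.

(** The part of [-1, 1] below a level k has length pos (k + 1) - pos (k - 1). The chord is the part
    between the levels [al] and [be], hence a difference of two such lengths. *)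
Lemma lebesgue_measure_chord (w b2 b3 : R) : 0 < b2 -> 0 < b3 ->
  lebesgue_measure [set z : measurableTypeR R | `|z| <= 1 /\ `|w + b2 * z| <= b3] =
  (b2^-1 * (pos (b3 + b2 - w) + -1 * pos (b3 - b2 - w) +
   -1 * pos (- b3 + b2 - w) + pos (- b3 - b2 - w)))%:E.
Proof.
move=> b20 b30; have b2n : b2 != 0 by rewrite gt_eqF.
pose al := (- b3 - w) / b2; pose be := (b3 - w) / b2.
have ab : al < be by rewrite ltr_pM2r ?invr_gt0//; lra.
have posM x : pos (b2 * x) = b2 * pos x.
  by rewrite /pos maxr_pMr ?mulr0// ltW.
have -> : b3 + b2 - w = b2 * (be + 1) by rewrite /be; field.
have -> : b3 - b2 - w = b2 * (be - 1) by rewrite /be; field.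
have -> : - b3 + b2 - w = b2 * (al + 1) by rewrite /al; field.
have -> : - b3 - b2 - w = b2 * (al - 1) by rewrite /al; field.
rewrite !posM.
have -> : b2^-1 * (b2 * pos (be + 1) + -1 * (b2 * pos (be - 1)) + -1 * (b2 * pos (al + 1)) +
  b2 * pos (al - 1)) = pos (be + 1) - pos (be - 1) - pos (al + 1) + pos (al - 1) by field.
rewrite (_ : [set z | _] = `[Num.max (- 1) al, Num.min 1 be]%classic); last first.
  apply/seteqP; split => z /=; rewrite in_itv /= !ler_norml ge_max le_min.
    move=> [/andP[-> ->] /andP[? ?]] /=.
    by rewrite /al /be ler_pdivrMr// ler_pdivlMr//; apply/andP; split; lra.
  rewrite /al /be ler_pdivrMr// ler_pdivlMr// => /andP[/andP[-> ?] /andP[-> ?]].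
  by split => //; apply/andP; split; lra.
rewrite lebesgue_measure_itv /= lte_fin.
case: (posP (be + 1)) => -[h1 ->]; case: (posP (be - 1)) => -[h2 ->];
case: (posP (al + 1)) => -[h3 ->]; case: (posP (al - 1)) => -[h4 ->];
case: (leP (- 1) al) => h5; case: (leP 1 be) => h6; case: ltP => h7;
  rewrite -?EFinB; congr (_%:E); lra.
Qed.

End Primitives.

(** * The volume of a section *)

Section SectionVolume.
Variable R : realType.
Local Notation mR := (measurableTypeR R).
Local Notation T := (mR * mR * mR)%type.
Implicit Types (x e k : R).

Lemma pos_sqrN x : pos x ^+ 2 = x ^+ 2 - pos (- x) ^+ 2.
Proof.
case: (posP x) => -[h ->]; case: (posP (- x)) => -[k ->]; rewrite ?expr0n ?subr0//=.
- by (have -> : x = 0 by lra); ring.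
- by rewrite sqrrN subrr.
- by (have -> : x = 0 by lra); ring.
Qed.

Lemma pos_cubeN x : pos x ^+ 3 = x ^+ 3 + pos (- x) ^+ 3.
Proof.
case: (posP x) => -[h ->]; case: (posP (- x)) => -[k ->]; rewrite ?expr0n ?addr0//=.
- by (have -> : x = 0 by lra); ring.
- by ring.
- by (have -> : x = 0 by lra); ring.
Qed.

(** Integrates pos t ^ 2 + pos (- t) ^ 2 = t ^ 2. It trades a term with positive argument for a
    polynomial minus a term with negative argument. *)
Lemma posint2_compl (t u : R) :
  posint2 t u = 2 * t ^+ 2 + 2 / 3 * u ^+ 2 - posint2 (- t) u.
Proof.
rewrite /posint2; case: eqVneq => [->|u0]; first by rewrite (pos_sqrN t); ring.
rewrite (pos_cubeN (t + u)) (pos_cubeN (t - u)).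
have -> : - (t + u) = - t - u by ring.
have -> : - (t - u) = - t + u by ring.
by field.
Qed.

(** For positive b1, b2, b3 this is b1 * b2 times the volume of the two opposite caps that the slab
    |b0 x0 + b1 x1 + b2 x2| <= b3 cuts off the cube: inclusion-exclusion over the signs of x1 and x2
    at the corners, with x0 integrated out. *)
Definition corner_defect (b0 b1 b2 b3 : R) : R :=
  posint2 (b1 + b2 - b3) b0 - posint2 (b2 - b1 - b3) b0
  - posint2 (b1 - b2 - b3) b0 + posint2 (- b1 - b2 - b3) b0.

(** Dividing by b3 puts the bound on the fourth coordinate at the same level 1 as the bound on the
    third, as [box_with] demands. *)
Definition slab_cube (b0 b1 b2 b3 : R) (x : T) : R :=
  Num.max (absform 0 0 1 0 x) (absform (b0 / b3) (b1 / b3) (b2 / b3) 0 x).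

Lemma measurable_slab_cube b0 b1 b2 b3 : measurable_fun setT (slab_cube b0 b1 b2 b3).
Proof. by apply: measurable_maxr; exact: measurable_abs_linear. Qed.

Lemma vol3_slab_cube b0 b1 b2 b3 : 0 < b1 -> 0 < b2 -> 0 < b3 ->
  vol3 [set x | box_with 0 1 (slab_cube b0 b1 b2 b3) x <= 0] =
  (8 - corner_defect b0 b1 b2 b3 / (b1 * b2))%:E.
Proof.
move=> b10 b20 b30.
have b1n : b1 != 0 by rewrite gt_eqF.
have b2n : b2 != 0 by rewrite gt_eqF.
have b3n : b3 != 0 by rewrite gt_eqF.
pose F x y := b2^-1 * (pos ((b3 + b2 - b0 * x) + - b1 * y) + -1 * pos ((b3 - b2 - b0 * x) + - b1 * y) +
   -1 * pos ((- b3 + b2 - b0 * x) + - b1 * y) + pos ((- b3 - b2 - b0 * x) + - b1 * y)).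
rewrite (@vol3_iter _ _ F (-1) 1); first last.
- move=> x y z /=; rewrite box_with_le0 /= sub0r add0r => /and3P[]; by [].
- move=> x y hx hy.
  rewrite -[F x y]/(b2^-1 * _).
  have := @lebesgue_measure_chord _ (b0 * x + b1 * y) b2 b3 b20 b30.
  have E c : c - (b0 * x + b1 * y) = (c - b0 * x) + - b1 * y by ring.
  rewrite !E => <-; congr (lebesgue_measure _); apply/seteqP.
  suff H z : box_with 0 1 (slab_cube b0 b1 b2 b3) (x, y, z) <= 0 <->
      `|z| <= 1 /\ `|b0 * x + b1 * y + b2 * z| <= b3 by split => z /= /H.
  rewrite box_with_le0 /= sub0r add0r hx hy /= /slab_cube ge_max /absform /=.
  have -> : 0 * x + 0 * y + 1 * z + 0 = z by ring.
  have -> : b0 / b3 * x + b1 / b3 * y + b2 / b3 * z + 0 =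
    (b0 * x + b1 * y + b2 * z) / b3 by field.
  rewrite normrM normfV (gtr0_norm b30) ler_pdivrMr// mul1r.
  by split => [/andP|[-> ->]].
- by apply: measurable_sublevel; apply: measurable_box_with; exact: measurable_slab_cube.
(* [J] is one of the four terms of the chord length integrated over the second coordinate; [JJ]
   below integrates it over the first as well. *)
pose J c x := (2 * - b1)^-1 * (pos ((c - b1) + - b0 * x) ^+ 2 + -1 * pos ((c + b1) + - b0 * x) ^+ 2).
pose G x := b2^-1 * (J (b3 + b2) x + -1 * J (b3 - b2) x + -1 * J (- b3 + b2) x + J (- b3 - b2) x).
have b1nn : - b1 != 0 by rewrite oppr_eq0.
have pJ c x : prim_int (fun y => pos ((c - b0 * x) + - b1 * y)) (J c x).
  have := prim_int_pos1 (c - b0 * x) b1nn.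
  congr prim_int; rewrite /J [RHS]mulrC; congr (_ / _).
  by rewrite mulN1r; congr (pos _ ^+ 2 - pos _ ^+ 2); ring.
under eq_integral => x _.
  rewrite (@prim_int_integral _ (F x) (G x)).
  over.
  apply: prim_intZ; apply: prim_intD; last exact: pJ.
  apply: prim_intD; last by apply: prim_intZ; exact: pJ.
  by apply: prim_intD; [exact: pJ|apply: prim_intZ; exact: pJ].
pose JJ c := (2 * - b1)^-1 * (posint2 (c - b1) (- b0) + -1 * posint2 (c + b1) (- b0)).
have pJJ c : prim_int (J c) (JJ c).
  by apply: prim_intZ; apply: prim_intD; [|apply: prim_intZ]; exact: prim_int_pos2.
rewrite (@prim_int_integral _ G (b2^-1 * (JJ (b3 + b2) + -1 * JJ (b3 - b2) + -1 * JJ (- b3 + b2) + JJ (- b3 - b2)))).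
  congr (_%:E); rewrite /JJ !posint2N /corner_defect.
  (* The four terms whose argument contains + b3 are reflected. Their polynomial parts sum to the 8,
     and each of the four remaining values then occurs twice, once per cap. *)
  rewrite (posint2_compl (b3 + b2 - b1)) (posint2_compl (b3 + b2 + b1)).
  rewrite (posint2_compl (b3 - b2 - b1)) (posint2_compl (b3 - b2 + b1)).
  have -> : - (b3 + b2 - b1) = b1 - b2 - b3 by ring.
  have -> : - (b3 + b2 + b1) = - b1 - b2 - b3 by ring.
  have -> : - (b3 - b2 - b1) = b1 + b2 - b3 by ring.
  have -> : - (b3 - b2 + b1) = b2 - b1 - b3 by ring.
  have -> : - b3 + b2 - b1 = b2 - b1 - b3 by ring.
  have -> : - b3 + b2 + b1 = b1 + b2 - b3 by ring.
  have -> : - b3 - b2 - b1 = - b1 - b2 - b3 by ring.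
  have -> : - b3 - b2 + b1 = b1 - b2 - b3 by ring.
  by field; rewrite b1n b2n.
apply: prim_intZ; apply: prim_intD; last exact: pJJ.
apply: prim_intD; last by apply: prim_intZ; exact: pJJ.
by apply: prim_intD; [exact: pJJ|apply: prim_intZ; exact: pJJ].
Qed.

Let slope (b : 'rV[R]_4) : T := (co b 0 / co b 3, co b 1 / co b 3, co b 2 / co b 3).

Lemma section_lift (b : 'rV[R]_4) : 0 < co b 3 ->
  @cube R 4 `&` orthc b = lift (slope b) @`
  [set x | box_with 0 1 (slab_cube (co b 0) (co b 1) (co b 2) (co b 3)) x <= 0].
Proof.
move=> b3; have b3n : co b 3 != 0 by rewrite gt_eqF.
have E (x : T) : box_with 0 1 (slab_cube (co b 0) (co b 1) (co b 2) (co b 3)) x <= 0 <->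
    forall i, -1 <= lift (slope b) x 0 i <= 1.
  have [l0 l1 l2 l3] := co_lift (slope b) x.
  rewrite box_with_le0 /= sub0r add0r /slab_cube ge_max /absform /=.
  have -> : 0 * x.1.1 + 0 * x.1.2 + 1 * x.2 + 0 = x.2 by ring.
  rewrite addr0 -[_ + _ + _]opprK -{1}l3 normrN !ler_norml.
  split.
    by move=> /and4P[h1 h2 h3 h4] i; case: (ord4E i) => ->;
      rewrite -/(co (lift _ _) _) ?l0 ?l1 ?l2 ?l3// -l3.
  move=> h; rewrite -{1 2}l0 -{1 2}l1 -{1 2}l2; apply/and4P.
  by split; [exact: (h (inord 0))|exact: (h (inord 1))|exact: (h (inord 2))|exact: (h (inord 3))].
apply/seteqP; split => [y [cy oy]|_ [x /= /E hx <-]]; last first.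
  split; first exact: hx.
  rewrite /orthc /= dotpE; have [-> -> -> ->] := co_lift (slope b) x.
  by rewrite /slope /=; field.
pose x : T := (co y 0, co y 1, co y 2).
have yE : lift (slope b) x = y.
  have [l0 l1 l2 l3] := co_lift (slope b) x.
  apply: co_inj => //; rewrite l3 /slope /x /=.
  move: oy; rewrite /orthc /= dotpE => oy.
  apply: (mulIf b3n); transitivity (- (co y 0 * co b 0 + co y 1 * co b 1 + co y 2 * co b 2)).
    by field.
  by lra.
by exists x => //=; apply/E => i; rewrite yE; exact: cy.
Qed.

Definition flat_density : R := density (zero3 R).

Lemma density_slope (b : 'rV[R]_4) : usphere b -> 0 < co b 3 -> density (slope b) = flat_density / co b 3.
Proof.
move=> nb b3; have b3n : co b 3 != 0 by rewrite gt_eqF.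
have nb2 : co b 0 ^+ 2 + co b 1 ^+ 2 + co b 2 ^+ 2 + co b 3 ^+ 2 = 1.
  by have := enorm_sqr b; rewrite nb expr1n dotpE => ->; ring.
rewrite density_norm /slope /= -/flat_density mulrC; congr (_ * _).
have -> : 1 + (co b 0 / co b 3) ^+ 2 + (co b 1 / co b 3) ^+ 2 + (co b 2 / co b 3) ^+ 2 =
  ((co b 3)^-1) ^+ 2.
  transitivity ((co b 0 ^+ 2 + co b 1 ^+ 2 + co b 2 ^+ 2 + co b 3 ^+ 2) / co b 3 ^+ 2); first by field.
  by rewrite nb2 div1r exprVn.
by rewrite sqrtr_sqr gtr0_norm ?invr_gt0.
Qed.

Lemma section_volE (b : 'rV[R]_4) : usphere b -> 0 < co b 1 -> 0 < co b 2 -> 0 < co b 3 ->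
  section_vol b = flat_density * ((8 - corner_defect (co b 0) (co b 1) (co b 2) (co b 3) /
    (co b 1 * co b 2)) / co b 3).
Proof.
move=> nb b1 b2 b3; rewrite /section_vol section_lift// -/(lift_vol (slope b) _).
rewrite (@lift_vol_box_with _ _ _ _ _
  (`|co b 0 / co b 3| + `|co b 1 / co b 3| + `|co b 2 / co b 3| + 1) 1).
- by rewrite vol3_slab_cube// density_slope// -EFinM /=; ring.
- exact: measurable_slab_cube.
- by rewrite !addr_ge0.
- apply: lip_max; [apply: lipW (@lip_abs_linear _ 0 0 1 0)|apply: lipW (@lip_abs_linear _ _ _ _ 0)].
    by rewrite normr0 !add0r normr1 lerDr !addr_ge0.
  by rewrite lerDl.
- move=> x1 x2; apply: (@sub_countable _ _ _ ([set z : R | absform 0 0 1 0 (x1, x2, z) = 1] `|`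
    [set z : R | absform (co b 0 / co b 3) (co b 1 / co b 3) (co b 2 / co b 3) 0 (x1, x2, z) = 1])).
    apply: subset_card_le => z /=; rewrite /slab_cube; case: leP => _; by [right|left].
  rewrite -bigcup2E; apply: bigcup_countable => //.
  by case=> [|[|i]] _ /=; [| |exact: countable0]; apply: slab_countable; rewrite ?divr_gt0.
- move=> x; rewrite box_with_le0 sub0r add0r /slab_cube ge_max /absform.
  have -> : 0 * x.1.1 + 0 * x.1.2 + 1 * x.2 + 0 = x.2 by ring.
  by rewrite -!ler_norml => /and3P[-> -> /andP[-> _]].
Qed.

(** The bounds on the first three coordinates already imply the one on the fourth, so the section is
    a graph over the whole cube. This reaches directions with co b 1 = 0, where the defect formula
    would divide by zero. *)
Lemma section_vol_full (b : 'rV[R]_4) : usphere b -> 0 < co b 3 ->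
  `|co b 0| + `|co b 1| + `|co b 2| <= co b 3 -> section_vol b = flat_density * (8 / co b 3).
Proof.
move=> nb b3 bs; have b3n : co b 3 != 0 by rewrite gt_eqF.
rewrite /section_vol section_lift//.
rewrite (_ : [set x | _] = [set x | box_with 0 1 (absform 0 0 1 0) x <= 0]).
  rewrite -/(lift_vol (slope b) _) lift_vol_slab// density_slope//=; field => //.
apply/seteqP; split => x /=; rewrite !box_with_le0 /slab_cube ge_max sub0r add0r.
  by case/and3P => -> -> /andP[].
move=> /and3P[h1 h2 h3]; rewrite h1 h2 h3 /= /absform.
move: h3; rewrite /absform.
have -> : 0 * x.1.1 + 0 * x.1.2 + 1 * x.2 + 0 = x.2 by ring.
have -> : co b 0 / co b 3 * x.1.1 + co b 1 / co b 3 * x.1.2 + co b 2 / co b 3 * x.2 + 0 =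
    (co b 0 * x.1.1 + co b 1 * x.1.2 + co b 2 * x.2) / co b 3 by field.
rewrite normrM normfV (gtr0_norm b3) ler_pdivrMr// mul1r => h3.
apply: le_trans bs; rewrite -ler_norml in h1; rewrite -ler_norml in h2.
have E (u v : R) : `|v| <= 1 -> `|u * v| <= `|u| by move=> ?; rewrite normrM ler_piMr.
apply: (le_trans (ler_normD _ _)); rewrite lerD ?E//.
by apply: (le_trans (ler_normD _ _)); rewrite lerD ?E.
Qed.
End SectionVolume.

(** * Differentials on the sphere *)

Section SphereDiff.
Variable R : realType.
Implicit Types (a b v : 'rV[R]_4) (f : 'rV[R]_4 -> R).

Lemma norm_rowP (n : nat) (x : 'rV[R]_n) (d : R) : 0 <= d -> `|x| <= d <-> forall i, `|x 0 i| <= d.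
Proof.
move=> d0; rewrite -[leLHS]/(mx_norm x) mx_normrE; split.
  by move=> /bigmax_leP[_ H] i; exact: (H (0, i)).
by move=> H; apply/bigmax_leP; split => // -[i j] _ /=; rewrite ord1.
Qed.

Lemma norm_le_enorm (x : 'rV[R]_4) : `|x| <= enorm x.
Proof.
apply/norm_rowP; first exact: sqrtr_ge0.
by move=> i; case: (ord4E i) => ->; exact: norm_co_le.
Qed.

Lemma enorm_le_2norm (x : 'rV[R]_4) : enorm x <= 2 * `|x|.
Proof. by apply: enorm_le_norm => //; apply/norm_rowP. Qed.

Lemma is_sphere_diffP f a (L : {linear 'rV[R]_4 -> R^o}) :
  is_sphere_diff f a L <->
  forall eps : R, 0 < eps -> exists2 d : R, 0 < d & forall b, usphere b ->
    enorm (b - a) <= d -> `|f b - f a - L (b - a)| <= eps * enorm (b - a).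
Proof.
split.
  move=> /cvgrPdist_le H eps eps0; have := H _ eps0.
  rewrite near_withinE => /nbhs_ballP[d /= d0 Hd].
  exists (d / 2); first by rewrite divr_gt0.
  move=> b bS bd.
  have [->|ba] := eqVneq b a.
    by rewrite !subrr linear0 subr0 normr0 mulr_ge0 ?sqrtr_ge0// ltW.
  have e0 : 0 < enorm (b - a).
    by rewrite (lt_le_trans _ (norm_le_enorm _))// normr_gt0 subr_eq0.
  have := Hd b; rewrite /= sub0r normrN normrM normfV (gtr0_norm e0) ler_pdivrMr//.
  apply=> //.
  rewrite -ball_normE /= distrC (le_lt_trans (norm_le_enorm _))// (le_lt_trans bd)//.
  by rewrite ltr_pdivrMr// ltr_pMr// ltr1n.
move=> H; apply/cvgrPdist_le => eps eps0; have [d d0 Hd] := H _ eps0.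
rewrite near_withinE; apply/nbhs_ballP; exists (d / 2) => /=; first by rewrite divr_gt0.
move=> b; rewrite -ball_normE /= distrC => bd ba bS.
have e0 : 0 < enorm (b - a).
  by rewrite (lt_le_trans _ (norm_le_enorm _))// normr_gt0 subr_eq0.
rewrite sub0r normrN normrM normfV (gtr0_norm e0) ler_pdivrMr//; apply: Hd => //.
by rewrite (le_trans (enorm_le_2norm _))// mulrC -ler_pdivlMr// ltW.
Qed.

Lemma co_linear k : linear (fun x : 'rV[R]_4 => co x k : R^o).
Proof. by move=> c x y; rewrite coD coZ. Qed.

(** Both forms are tested along a rational curve on the sphere through [a] with velocity 2 v.
    Uniqueness on tangent vectors lets the differential of a model stand for the one provided by
    [sphere_critical]. *)
Lemma sphere_diff_unique f a v (L L' : {linear 'rV[R]_4 -> R^o}) : usphere a -> orthc a v ->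
  is_sphere_diff f a L -> is_sphere_diff f a L' -> L v = L' v.
Proof.
move=> aS av /is_sphere_diffP HL /is_sphere_diffP HL'.
have aa : dotp a a = 1 by rewrite -enorm_sqr aS expr1n.
have [->|v0] := eqVneq v 0; first by rewrite !linear0.
have vv : 0 < dotp v v.
  rewrite -enorm_sqr exprn_gt0// (lt_le_trans _ (norm_le_enorm _))// normr_gt0//.
set q := dotp v v.
apply/eqP; rewrite -subr_eq0 -normr_le0; apply/ler_addgt0Pl => eps eps0; rewrite addr0.
(* Since |b - a| <= (2 t / s) (q + 1), the two remainders together stay below (2 t / s) (eps / 2).
   The other eps / 2 is kept for t q D, which comes from the component of b - a along [a]. *)
have e4 : 0 < eps / (4 * (q + 1)) by rewrite divr_gt0// mulr_gt0// addr_gt0.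
have [d d0 Hd] := HL _ e4; have [d' d'0 Hd'] := HL' _ e4.
(* The points ((1 - t^2 q) a + 2 t v) / (1 + t^2 q), q = |v|^2, lie on the sphere. *)
pose D := L a - L' a.
pose t := Num.min (Num.min 1 (eps / (2 * (q * `|D| + 1)))) (Num.min d d' / (4 * (q + 1))).
have qD0 : 0 < 2 * (q * `|D| + 1) by rewrite mulr_gt0// ltr_wpDl// mulr_ge0// ltW.
have q40 : 0 < 4 * (q + 1) by rewrite mulr_gt0// addr_gt0.
have dd0 : 0 < Num.min d d' by rewrite lt_min d0 d'0.
have t0 : 0 < t by rewrite !lt_min ltr01 !divr_gt0.
have t1 : t <= 1 by rewrite !ge_min lexx.
have t2 : t <= eps / (2 * (q * `|D| + 1)) by rewrite !ge_min lexx orbT.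
have t3 : t <= Num.min d d' / (4 * (q + 1)) by rewrite ge_min lexx orbT.
pose s := 1 + t ^+ 2 * q.
have s1 : 1 <= s by rewrite lerDl mulr_ge0 ?sqr_ge0 ?ltW.
have s0 : 0 < s by exact: lt_le_trans s1.
have sn : s != 0 by rewrite gt_eqF.
pose b := s^-1 *: ((1 - t ^+ 2 * q) *: a + (2 * t) *: v).
have bE : b - a = (2 * t / s) *: (v - (t * q) *: a).
  apply/rowP => i; rewrite !mxE /s; field; exact: sn.
have nE : dotp (v - (t * q) *: a) (v - (t * q) *: a) = q * s.
  transitivity (dotp v v - 2 * (t * q) * dotp v a + (t * q) ^+ 2 * dotp a a).
    by rewrite !dotpE !coB !coZ; ring.
  by rewrite av aa /s -/q; ring.
have bS : usphere b.
  rewrite /usphere /= /enorm; have -> : dotp b b = 1; last by rewrite sqrtr1.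
  transitivity (((1 - t ^+ 2 * q) ^+ 2 * dotp a a + 4 * t * (1 - t ^+ 2 * q) * dotp v a + 4 * t ^+ 2 * dotp v v) / s ^+ 2).
    by rewrite !dotpE /b !coZ !coD !coZ; field; exact: sn.
  by rewrite av aa -/q /s; field; exact: sn.
have nb : enorm (b - a) = 2 * t / s * Num.sqrt (q * s).
  rewrite bE -nE /enorm; set w := v - _.
  have -> : dotp (2 * t / s *: w) (2 * t / s *: w) = (2 * t / s) ^+ 2 * dotp w w.
    by rewrite !dotpE !coZ; ring.
  by rewrite sqrtrM ?sqr_ge0// sqrtr_sqr gtr0_norm// divr_gt0// mulr_gt0.
have sq : Num.sqrt (q * s) <= q + 1.
  rewrite -[leRHS]ger0_norm; last by rewrite addr_ge0// ltW.
  rewrite -sqrtr_sqr ler_wsqrtr//.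
  have t21 : t ^+ 2 <= 1 by rewrite expr_le1// ltW.
  have : q ^+ 2 * t ^+ 2 <= q ^+ 2 * 1 by rewrite ler_wpM2l// sqr_ge0.
  rewrite /s; move: vv; rewrite -/q; lra.
have ts0 : 0 < 2 * t / s by rewrite divr_gt0// mulr_gt0.
have nbd : enorm (b - a) <= Num.min d d'.
  rewrite nb; apply: (@le_trans _ _ (2 * t / s * (q + 1))).
    by rewrite ler_wpM2l// ltW.
  have : 2 * t / s * (q + 1) <= 2 * t * (q + 1).
    apply: ler_wpM2r; first by rewrite addr_ge0// ltW.
    by rewrite ler_pdivrMr// ler_peMr// mulr_ge0// ltW.
  move: t3; rewrite ler_pdivlMr ?mulr_gt0 ?addr_gt0// => t3.
  have : 0 <= t * (q + 1) by rewrite mulr_ge0// ?addr_ge0// ltW.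
  lra.
have := Hd b bS (le_trans nbd _); rewrite ge_min lexx => /(_ isT) h1.
have := Hd' b bS (le_trans nbd _); rewrite ge_min lexx orbT => /(_ isT) h2.
have h3 : `|L (b - a) - L' (b - a)| <= 2 * (eps / (4 * (q + 1)) * enorm (b - a)).
  have -> : L (b - a) - L' (b - a) = (f b - f a - L' (b - a)) - (f b - f a - L (b - a)) by ring.
  apply: (le_trans (ler_normB _ _)); lra.
have E : L (b - a) - L' (b - a) = 2 * t / s * ((L v - L' v) - t * q * D).
  have EM (M : {linear 'rV[R]_4 -> R^o}) :
      M (b - a) = 2 * t / s * (M v - t * q * M a) by rewrite bE linearZ linearB linearZ.
  by rewrite !EM /D; ring.
have h4 : `|(L v - L' v) - t * q * D| <= eps / 2.
  rewrite -(ler_pM2l ts0) -{1}(gtr0_norm ts0) -normrM -E (le_trans h3)// nb.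
  have -> : 2 * (eps / (4 * (q + 1)) * (2 * t / s * Num.sqrt (q * s))) =
    2 * t / s * (eps / 2 * (Num.sqrt (q * s) / (q + 1))).
    by field; rewrite sn /= gt_eqF// addr_gt0.
  rewrite ler_pM2l// -[leRHS]mulr1 ler_wpM2l ?divr_ge0 ?(ltW eps0)//.
  by rewrite ler_pdivrMr ?addr_gt0// mul1r.
have h5 : `|t * q * D| <= eps / 2.
  rewrite !normrM (gtr0_norm t0) (gtr0_norm vv) -mulrA.
  have k0 : 0 <= q * `|D| by rewrite mulr_ge0// ltW.
  apply: (@le_trans _ _ (t * (q * `|D| + 1))); first by rewrite ler_wpM2l ?(ltW t0)// lerDl.
  move: t2; rewrite !ler_pdivlMr ?mulr_gt0 ?ltr_wpDl//; lra.
have -> : L v - L' v = ((L v - L' v) - t * q * D) + t * q * D by ring.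
apply: (le_trans (ler_normD _ _)); lra.
Qed.

(** A quadratic error is o(|b - a|), so [f] inherits the differential of [g]; the bound at b = a
    gives f a = g a. *)
Lemma sphere_diff_comparison f g a (C d : R) : usphere a -> differentiable g a -> 0 < d ->
  (forall b, usphere b -> `|b - a| <= d -> `|f b - g b| <= C * `|b - a| ^+ 2) ->
  is_sphere_diff f a ('d g a).
Proof.
move=> aS dg d0 fg; apply/is_sphere_diffP => eps eps0.
have fga : f a = g a.
  apply/eqP; rewrite -subr_eq0 -normr_le0; have := fg a aS.
  by rewrite subrr normr0 expr0n mulr0; apply; exact: ltW.
have e2 : 0 < eps / 2 by rewrite divr_gt0.
have /eqaddoP/(_ _ e2)/nbhs_ballP[r /= r0 Hr] := diff_locally dg.
have C1 : 0 < `|C| + 1 by rewrite ltr_wpDl.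
pose e := Num.min d (Num.min (r / 2) (eps / (2 * (`|C| + 1)))).
have e0 : 0 < e by rewrite !lt_min d0 !divr_gt0// mulr_gt0.
exists e => // b bS be.
set n := `|b - a|; have nle : n <= enorm (b - a) by exact: norm_le_enorm.
have ne : n <= e by exact: le_trans be.
have n0 : 0 <= n by exact: normr_ge0.
have n1 : n <= d by rewrite (le_trans ne)// ge_min lexx.
have n2 : n <= r / 2 by rewrite (le_trans ne)// !ge_min lexx orbT.
have n3 : n <= eps / (2 * (`|C| + 1)) by rewrite (le_trans ne)// !ge_min lexx !orbT.
have h1 := fg b bS n1.
have h2 : `|g b - g a - 'd g a (b - a)| <= eps / 2 * n.
  have := Hr (b - a); rewrite /= -ball_normE /= sub0r normrN => H.
  have : n < r by lra.
  move=> /H; rewrite !fctE /= /shift /= subrK.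
  by rewrite opprD addrA.
rewrite -/n in h1.
have h3 : C * n ^+ 2 <= eps / 2 * n.
  rewrite expr2 mulrA ler_wpM2r//; apply: (@le_trans _ _ ((`|C| + 1) * n)).
    by rewrite ler_wpM2r// (le_trans (ler_norm _))// lerDl.
  move: n3; rewrite ler_pdivlMr ?mulr_gt0//; lra.
rewrite fga.
have -> : f b - g a - 'd g a (b - a) = (f b - g b) + (g b - g a - 'd g a (b - a)) by ring.
apply: (le_trans (ler_normD _ _)).
have : eps * n <= eps * enorm (b - a) by rewrite ler_wpM2l// ltW.
lra.
Qed.

(** A known differential excludes the second way of being critical, and by uniqueness agrees on
    tangent vectors with the form of the first. *)
Lemma sphere_criticalW f a : usphere a -> sphere_critical f a -> forall L : {linear 'rV[R]_4 -> R^o},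
  is_sphere_diff f a L -> forall v, orthc a v -> L v = 0.
Proof.
move=> aS [[L' hL' L'0] L hL v av|nd L hL]; last by exfalso; apply: nd; exists L.
by rewrite (sphere_diff_unique aS av hL hL') L'0.
Qed.
End SphereDiff.

(** * Signed permutations *)

Section SignedPerm.
Variable R : realType.
Implicit Types (a b x y : 'rV[R]_4) (s : 'S_4) (e : 'I_4 -> bool).

Definition sperm s e x : 'rV[R]_4 := \row_i ((-1) ^+ e i * x 0 (s i)).

Fact sperm_linear s e : linear (sperm s e).
Proof. by move=> c x y; apply/rowP => i; rewrite !mxE; ring. Qed.
HB.instance Definition _ s e :=
  GRing.isLinear.Build R 'rV[R]_4 'rV[R]_4 *:%R (sperm s e) (sperm_linear s e).

Lemma dotp_sperm s e x y : dotp (sperm s e x) (sperm s e y) = dotp x y.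
Proof.
rewrite /dotp [RHS](reindex_inj (@perm_inj _ s)); apply: eq_bigr => i _.
by rewrite !mxE mulrACA -expr2 sqrr_sign mul1r.
Qed.

Lemma enorm_sperm s e x y : enorm (sperm s e x - sperm s e y) = enorm (x - y).
Proof. by rewrite -linearB; apply: eq_enorm; rewrite dotp_sperm. Qed.

Lemma spermK s e x : sperm s^-1 (fun i => e (s^-1%g i)) (sperm s e x) = x.
Proof.
by apply/rowP => i; rewrite !mxE mulrA -expr2 sqrr_sign mul1r permKV.
Qed.

Lemma spermVK s e x : sperm s e (sperm s^-1 (fun i => e (s^-1%g i)) x) = x.
Proof.
by apply/rowP => i; rewrite !mxE permK mulrA -expr2 sqrr_sign mul1r.
Qed.

Lemma cube_sperm s e x : cube x -> cube (sperm s e x).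
Proof.
move=> cx i; rewrite mxE; have /andP[? ?] := cx (s i).
by case: (e i); rewrite ?expr0 ?expr1 ?mul1r ?mulN1r; apply/andP; split; lra.
Qed.

Lemma section_vol_sperm s e a : section_vol (sperm s e a) = section_vol a.
Proof.
rewrite /section_vol; congr fine.
rewrite -(@hausdorff3_isometry _ _ (sperm s e) (sperm s^-1 (fun i => e (s^-1%g i))) (@cube R 4 `&` orthc a)).
- congr hausdorff3; apply/seteqP; split => [x [cx ox]|_ [x [cx ox] <-]].
    exists (sperm s^-1 (fun i => e (s^-1%g i)) x); last exact: spermVK.
    split; first exact: cube_sperm.
    by rewrite /orthc /= -(dotp_sperm s e) spermVK.
  by split; [exact: cube_sperm|rewrite /orthc /= dotp_sperm].
- exact: enorm_sperm.
- exact: enorm_sperm.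
- by move=> x _; exact: spermK.
Qed.

Lemma usphere_sperm s e a : usphere a -> usphere (sperm s e a).
Proof. by rewrite /usphere /= => <-; apply: eq_enorm; rewrite dotp_sperm. Qed.

Lemma is_sphere_diff_sperm s e a (L : {linear 'rV[R]_4 -> R^o}) :
  is_sphere_diff (@section_vol R) (sperm s e a) L ->
  is_sphere_diff (@section_vol R) a (L \o sperm s e).
Proof.
move=> /is_sphere_diffP H; apply/is_sphere_diffP => eps eps0.
have [d d0 Hd] := H eps eps0; exists d => // b bS bd.
have := Hd (sperm s e b) (usphere_sperm _ _ bS).
by rewrite !section_vol_sperm enorm_sperm -linearB; apply.
Qed.

Lemma critical_direction_sperm s e a :
  critical_direction a -> critical_direction (sperm s e a).
Proof.
move=> [aS crit]; split; first exact: usphere_sperm.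
set si := s^-1%g; set ei := fun i => e (si i).
have aE : sperm si ei (sperm s e a) = a by exact: spermK.
case: crit => [[L dL L0]|nd]; [left|right].
  exists (L \o sperm si ei); first by apply: is_sphere_diff_sperm; rewrite aE.
  move=> v av /=; apply: L0; rewrite /orthc /= -(dotp_sperm s e).
  by rewrite /si /ei spermVK.
by move=> [L dL]; apply: nd; exists (L \o sperm s e); exact: is_sphere_diff_sperm.
Qed.

Lemma eq_upto_perm_sign_sperm s e a b :
  eq_upto_perm_sign (sperm s e a) b -> eq_upto_perm_sign a b.
Proof.
move=> [s' [e' h]]; exists (s^-1 * s')%g, (fun j => e (s^-1%g j) (+) e' (s^-1%g j)) => j.
have := h (s^-1%g j); rewrite mxE permKV permM => hj.
by rewrite signr_addb -mulrA -hj mulrA -expr2 sqrr_sign mul1r.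
Qed.

Definition sorted4 a := [/\ 0 <= co a 0, co a 0 <= co a 1, co a 1 <= co a 2 & co a 2 <= co a 3].

Lemma sorting_sperm a : exists s e, sorted4 (sperm s e a).
Proof.
pose t := [tuple `|a 0 i| | i < 4].
have /tuple_permP[s hs] : perm_eq (sort <=%R t) t by rewrite perm_sort.
have sz : size (sort <=%R t) = 4 by rewrite size_sort size_tuple.
pose e i := a 0 (s i) < 0.
have nthE (i : 'I_4) : nth 0 (sort <=%R t) i = sperm s e a 0 i.
  rewrite hs (nth_map ord0) ?size_enum_ord// nth_ord_enum tnth_map tnth_ord_tuple mxE /e.
  by case: ltP => h; [rewrite ltr0_norm// mulN1r|rewrite ger0_norm// mul1r].
exists s, e.
have so : sorted <=%R (sort <=%R t) by exact: sort_le_sorted.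
have le i j : (i <= j)%N -> (j < 4)%N -> co (sperm s e a) i <= co (sperm s e a) j.
  move=> ij j4; have i4 : (i < 4)%N by exact: leq_ltn_trans ij j4.
  rewrite /co -!nthE !inordK//.
  by apply: (sorted_leq_nth le_trans lexx) => //; rewrite inE sz.
split; try exact: le.
by rewrite /co mxE /e; case: ltP => h; [rewrite mulN1r oppr_ge0 ltW|rewrite mul1r].
Qed.
End SignedPerm.

(** * The Lagrange equations *)

Section Algebra.
Variable R : realFieldType.
Implicit Types (p r s x y z w b N : R).

Lemma mul_eq0_neq (u v : R) : u != 0 -> u * v = 0 -> v = 0.
Proof. by move=> u0 /eqP; rewrite mulf_eq0 (negbTE u0) => /eqP. Qed.

(** [p] and [r] are the two roots of N X^2 - 3 s^2 X + s^3, so Vieta gives N (p + r) = 3 s^2 and N p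
    r = s^3, hence s (p + r) = 3 p r. Eliminating N, s and w from the sphere equation leaves a form
    in [p] and [r] with the factor 2 p - r. *)
Lemma two_values p r w s N : 0 < p -> 0 < r -> p != r -> s = 2 * p + r - w ->
  N = 24 * (p ^+ 2 * r) - s ^+ 3 -> 2 * p ^+ 2 + r ^+ 2 + w ^+ 2 = 1 ->
  N * p ^+ 2 = 3 * s ^+ 2 * p - s ^+ 3 -> N * r ^+ 2 = 3 * s ^+ 2 * r - s ^+ 3 -> 0 < s ->
  r = 2 * p /\ w = 2 * p.
Proof.
move=> p0 r0 pr sE NE q ep er s0.
have dpr : p - r != 0 by rewrite subr_eq0.
have S0 : 0 < p + r by rewrite addr_gt0.
have h1 : N * (p + r) = 3 * s ^+ 2.
  apply/eqP; rewrite -subr_eq0; apply/eqP; apply: (mul_eq0_neq dpr).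
  transitivity ((N * p ^+ 2 - 3 * s ^+ 2 * p) - (N * r ^+ 2 - 3 * s ^+ 2 * r)); first by ring.
  by rewrite ep er; ring.
have h2 : N * (p * r) = s ^+ 3.
  have : N * p ^+ 2 = N * (p + r) * p - s ^+ 3 by rewrite h1 ep.
  move=> h; transitivity (N * (p + r) * p - N * p ^+ 2); first by ring.
  by rewrite h; ring.
have s2n : s ^+ 2 != 0 by rewrite expf_neq0// gt_eqF.
have h3 : s * (p + r) = 3 * (p * r).
  apply/eqP; rewrite -subr_eq0; apply/eqP; apply: (mul_eq0_neq s2n).
  transitivity (s ^+ 3 * (p + r) - 3 * s ^+ 2 * (p * r)); first by ring.
  by rewrite -h2 -h1; ring.
set S := p + r in S0 h1 h3.
have h4 : w * S = 2 * p ^+ 2 + r ^+ 2.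
  have -> : w = 2 * p + r - s by rewrite sE; ring.
  by rewrite mulrBl h3 /S; ring.
have h5 : (24 * (p ^+ 2 * r) - s ^+ 3) * S = 3 * s ^+ 2 * (2 * p ^+ 2 + r ^+ 2 + w ^+ 2).
  by rewrite q mulr1 -h1 NE.
have h6 : 24 * (p ^+ 2 * r) * S ^+ 5 - (s * S) ^+ 3 * S ^+ 2 =
    3 * (s * S) ^+ 2 * ((2 * p ^+ 2 + r ^+ 2) * S ^+ 2 + (w * S) ^+ 2).
  transitivity ((24 * (p ^+ 2 * r) - s ^+ 3) * S * S ^+ 4); first by ring.
  by rewrite h5; ring.
have k0 : 3 * (p ^+ 2 * r) != 0 by rewrite mulf_neq0 ?gt_eqF// mulr_gt0// exprn_gt0.
have S4n : S ^+ 4 != 0 by rewrite expf_neq0// gt_eqF.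
(* The cofactor of 2 p - r is a quartic form, written in t = 3 r / S as a square plus a quadratic of
   negative discriminant, hence positive. *)
have h7 : (2 * p - r) * (S ^+ 4 * (((3 * r / S) ^+ 2 - 3 * (3 * r / S) + 1) ^+ 2
    + 7 * (3 * r / S) ^+ 2 - 15 * (3 * r / S) + 11)) = 0.
  apply: (mul_eq0_neq k0).
  transitivity (3 * (24 * (p ^+ 2 * r) * S ^+ 5 - (3 * (p * r)) ^+ 3 * S ^+ 2 -
    3 * (3 * (p * r)) ^+ 2 * ((2 * p ^+ 2 + r ^+ 2) * S ^+ 2 + (2 * p ^+ 2 + r ^+ 2) ^+ 2))).
    by rewrite /S; field; rewrite gt_eqF.
  by rewrite h3 h4 in h6; rewrite h6 subrr mulr0.
have : S ^+ 4 * (((3 * r / S) ^+ 2 - 3 * (3 * r / S) + 1) ^+ 2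
    + 7 * (3 * r / S) ^+ 2 - 15 * (3 * r / S) + 11) != 0.
  rewrite mulf_neq0// gt_eqF//; move: (3 * r / S) => t.
  have := sqr_ge0 (t ^+ 2 - 3 * t + 1); have := sqr_ge0 (t - 15 / 14); lra.
move=> nz; have r2 : r = 2 * p.
  by apply/eqP; rewrite eq_sym -subr_eq0; apply/eqP; apply: (mul_eq0_neq nz); rewrite mulrC.
split => //; have Sn : S != 0 by rewrite gt_eqF.
by apply: (mulIf Sn); rewrite h4 /S r2; ring.
Qed.

(** Elimination gives w - x times a quartic form. That form is negative for x <= w < 3 x: from w = 2
    x on its first term is nonpositive, and before that this term is at most 9/4 x^4, below 3 w x^3
    + 3 x^4. *)
Lemma one_value x w s N : 0 < x -> x <= w -> s = 3 * x - w -> 0 < s ->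
  N = 24 * x ^+ 3 - s ^+ 3 -> 3 * x ^+ 2 + w ^+ 2 = 1 ->
  N * x ^+ 2 = 3 * s ^+ 2 * x - s ^+ 3 -> w = x.
Proof.
move=> x0 xw sE s0 NE q e.
have h : (w - x) * (w ^+ 2 * ((w - 2 * x) * (w - 3 * x)) - 3 * w * x ^+ 3 - 3 * x ^+ 4) = 0.
  transitivity (s ^+ 2 * w * (3 * x ^+ 2 + w ^+ 2) - (24 * x ^+ 3 - s ^+ 3) * x ^+ 2).
    by rewrite sE; ring.
  by rewrite q -NE e sE; ring.
have n : w ^+ 2 * ((w - 2 * x) * (w - 3 * x)) - 3 * w * x ^+ 3 - 3 * x ^+ 4 < 0.
  have w0 : 0 < w by exact: lt_le_trans xw.
  have x4 : 0 < x ^+ 4 by rewrite exprn_gt0.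
  have wx3 : 0 < w * x ^+ 3 by rewrite mulr_gt0// exprn_gt0.
  have [w2|w2] := leP (2 * x) w.
    have : 0 <= w ^+ 2 * ((w - 2 * x) * (3 * x - w)).
      by rewrite mulr_ge0 ?sqr_ge0// mulr_ge0//; lra.
    have -> : w ^+ 2 * ((w - 2 * x) * (3 * x - w)) = - (w ^+ 2 * ((w - 2 * x) * (w - 3 * x))) by ring.
    lra.
  have -> : w ^+ 2 * ((w - 2 * x) * (w - 3 * x)) = (w * (2 * x - w)) * (w * (3 * x - w)) by ring.
  have : (w * (2 * x - w)) * (w * (3 * x - w)) <= x ^+ 2 * (9 / 4 * x ^+ 2).
    apply: ler_pM.
    - by rewrite mulr_ge0//; lra.
    - by rewrite mulr_ge0//; lra.
    - by have := sqr_ge0 (w - x); lra.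
    - by have := sqr_ge0 (w - 3 / 2 * x); lra.
  have -> : x ^+ 2 * (9 / 4 * x ^+ 2) = 9 / 4 * x ^+ 4 by ring.
  lra.
have nz : w ^+ 2 * ((w - 2 * x) * (w - 3 * x)) - 3 * w * x ^+ 3 - 3 * x ^+ 4 != 0 by rewrite lt_eqF.
by apply/eqP; rewrite -subr_eq0; apply/eqP; apply: (mul_eq0_neq nz); rewrite mulrC.
Qed.

(** [x], [y] and [z] are roots of one quadratic, so at most two values are distinct, and the order
    of the coordinates decides which two may coincide. Here [N] and [s] are those of the Lagrange
    equations after multiplication by 3 x. *)
Lemma critical_mixed x y z w s N : 0 < x -> x <= y -> y <= z -> z <= w ->
  s = x + y + z - w -> 0 < s -> N = 24 * (x * y * z) - s ^+ 3 ->
  x ^+ 2 + y ^+ 2 + z ^+ 2 + w ^+ 2 = 1 ->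
  N * x ^+ 2 = 3 * s ^+ 2 * x - s ^+ 3 -> N * y ^+ 2 = 3 * s ^+ 2 * y - s ^+ 3 ->
  N * z ^+ 2 = 3 * s ^+ 2 * z - s ^+ 3 -> N * w ^+ 2 = N - 3 * s ^+ 2 * w ->
  [/\ y = x, z = x & w = x] \/ [/\ y = x, z = 2 * x & w = 2 * x].
Proof.
move=> x0 xy yz zw sE s0 NE q ex ey ez ew.
have y0 : 0 < y by exact: lt_le_trans xy.
have z0 : 0 < z by exact: lt_le_trans yz.
have w0 : 0 < w by exact: lt_le_trans zw.
have [yx|yx] := eqVneq y x; have [zy|zy] := eqVneq z y.
- subst z; subst y; left; split => //.
  have sE' : s = 3 * x - w by rewrite sE; ring.
  have NE' : N = 24 * x ^+ 3 - s ^+ 3 by rewrite NE; ring.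
  have q' : 3 * x ^+ 2 + w ^+ 2 = 1 by rewrite -[RHS]q; ring.
  exact: one_value x0 zw sE' s0 NE' q' ex.
- subst y; right; have xz : x != z by rewrite eq_sym.
  have sE' : s = 2 * x + z - w by rewrite sE; ring.
  have NE' : N = 24 * (x ^+ 2 * z) - s ^+ 3 by rewrite NE; ring.
  have q' : 2 * x ^+ 2 + z ^+ 2 + w ^+ 2 = 1 by rewrite -[RHS]q; ring.
  by have [-> ->] := two_values x0 z0 xz sE' NE' q' ex ez s0.
- subst z; exfalso.
  have sE' : s = 2 * y + x - w by rewrite sE; ring.
  have NE' : N = 24 * (y ^+ 2 * x) - s ^+ 3 by rewrite NE; ring.
  have q' : 2 * y ^+ 2 + x ^+ 2 + w ^+ 2 = 1 by rewrite -[RHS]q; ring.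
  have [h _] := two_values y0 x0 yx sE' NE' q' ey ex s0; lra.
- exfalso.
  have dxy : y - x != 0 by rewrite subr_eq0.
  have dyz : z - y != 0 by rewrite subr_eq0.
  have h1 : N * (y + x) = 3 * s ^+ 2.
    apply/eqP; rewrite -subr_eq0; apply/eqP; apply: (mul_eq0_neq dxy).
    transitivity ((N * y ^+ 2 - 3 * s ^+ 2 * y) - (N * x ^+ 2 - 3 * s ^+ 2 * x)); first by ring.
    by rewrite ex ey; ring.
  have h2 : N * (z + y) = 3 * s ^+ 2.
    apply/eqP; rewrite -subr_eq0; apply/eqP; apply: (mul_eq0_neq dyz).
    transitivity ((N * z ^+ 2 - 3 * s ^+ 2 * z) - (N * y ^+ 2 - 3 * s ^+ 2 * y)); first by ring.
    by rewrite ez ey; ring.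
  have N0 : N != 0.
    apply/eqP => N0; move: h1; rewrite N0 mul0r => /esym/eqP.
    by rewrite mulf_eq0 expf_eq0 /= (gt_eqF s0) pnatr_eq0.
  have : z - x = 0.
    apply: (mul_eq0_neq N0); transitivity (N * (z + y) - N * (y + x)); first by ring.
    by rewrite h1 h2 subrr.
  move=> zx; have : z - y > 0 by rewrite lt_neqAle eq_sym dyz /= subr_ge0.
  lra.
Qed.

(** The first equation says x = 0 or N = 4/3. As [y] and [z] are roots of N X^2 - 4 b X + 2 (b^2 +
    x^2 / 3), also y = z or N (y + z) = 4 b. With y = z these give the 3-diagonal and the
    4-diagonal; with N (y + z) = 4 b, the 3-diagonal again and (1,1,2,2). The sphere equation serves
    to make the definition of [N] homogeneous. *)
Lemma critical_even x y z w b N : 0 <= x -> x <= y -> 0 < y -> y <= z -> z <= w ->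
  b = y + z - w -> x <= b -> N = 8 * (y * z) - 2 * (b ^+ 2 + x ^+ 2 / 3) ->
  x ^+ 2 + y ^+ 2 + z ^+ 2 + w ^+ 2 = 1 ->
  N * x ^+ 2 = 4 / 3 * x ^+ 2 ->
  N * y ^+ 2 = 4 * b * y - 2 * (b ^+ 2 + x ^+ 2 / 3) ->
  N * z ^+ 2 = 4 * b * z - 2 * (b ^+ 2 + x ^+ 2 / 3) ->
  N * w ^+ 2 = N - 4 * b * w ->
  [\/ [/\ y = x, z = x & w = x], [/\ x = 0, z = y & w = y] |
      [/\ y = x, z = 2 * x & w = 2 * x]].
Proof.
move=> x0 xy y0 yz zw bE xb NE q ex ey ez ew.
have z0 : 0 < z by exact: lt_le_trans yz.
have w0 : 0 < w by exact: lt_le_trans zw.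
(* If b = 0 then x = 0, and the equation for y becomes 8 y z y^2 = 0. *)
have b0 : 0 < b.
  rewrite lt_neqAle (le_trans x0 xb) andbT; apply/eqP => b0.
  have x00 : x = 0 by apply/eqP; rewrite eq_le x0 b0 xb.
  move: ey; rewrite -b0 x00 NE -b0 x00 => h.
  have : 0 < y * z * y ^+ 2 by rewrite !mulr_gt0// exprn_gt0.
  lra.
have hyz : (z - y) * (N * (y + z) - 4 * b) = 0.
  transitivity ((N * z ^+ 2 - 4 * b * z) - (N * y ^+ 2 - 4 * b * y)); first by ring.
  by rewrite ey ez; ring.
(* Combining the sphere equation with that for w gives N (x^2 + y^2 + z^2) = 4 b w. *)
have N0 : 0 < N.
  have : N * (x ^+ 2 + y ^+ 2 + z ^+ 2) = 4 * b * w.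
    transitivity (N * (x ^+ 2 + y ^+ 2 + z ^+ 2 + w ^+ 2) - N * w ^+ 2); first by ring.
    by rewrite q ew; ring.
  have b4w : 0 < 4 * b * w by rewrite !mulr_gt0.
  have p0 : 0 < x ^+ 2 + y ^+ 2 + z ^+ 2.
    by rewrite ltr_pwDr ?exprn_gt0// addr_ge0 ?sqr_ge0.
  by move=> h; rewrite -(pmulr_lgt0 _ p0) h.
have xcase : x = 0 \/ N = 4 / 3.
  have [->|xn] := eqVneq x 0; [by left|right].
  have x2 : x ^+ 2 != 0 by rewrite expf_neq0.
  exact: (mulIf x2).
have wb : w = y + z - b by rewrite bE; ring.
have NEq : 8 * (y * z) - 2 * (b ^+ 2 + x ^+ 2 / 3) = N * (x ^+ 2 + y ^+ 2 + z ^+ 2 + w ^+ 2).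
  by rewrite q mulr1 NE.
move/eqP: hyz; rewrite mulf_eq0 subr_eq0 => /orP[/eqP zy|/eqP].
  subst z; have bE2 : b = 2 * y - w by rewrite bE; ring.
  case: xcase => [x00|N43].
    apply: Or32; split => //; subst x.
    have e1 : N * y ^+ 2 = 2 * w * b by rewrite ey bE2; field.
    have e2 : (8 * (y * y) - 2 * b ^+ 2) * y ^+ 2 = 2 * w * b * (2 * y ^+ 2 + w ^+ 2).
      transitivity (N * y ^+ 2 * (2 * y ^+ 2 + w ^+ 2)); last by rewrite e1.
      transitivity ((8 * (y * y) - 2 * (b ^+ 2 + 0 ^+ 2 / 3)) * y ^+ 2); first by field.
      by rewrite NEq; ring.
    have e3 : (2 * w ^+ 2) * (w - y) ^+ 2 = 0.
      transitivity ((8 * (y * y) - 2 * b ^+ 2) * y ^+ 2 - 2 * w * b * (2 * y ^+ 2 + w ^+ 2)).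
        rewrite bE2.
        by ring.
      by rewrite e2 subrr.
    have wn : 2 * w ^+ 2 != 0 by rewrite mulf_neq0 ?pnatr_eq0// expf_neq0// gt_eqF.
    have /eqP := mul_eq0_neq wn e3.
    by rewrite expf_eq0 /= subr_eq0 => /eqP.
  have e1 : x ^+ 2 = 6 * y * w - 3 * w ^+ 2 - 2 * y ^+ 2.
    rewrite N43 bE2 in ew; lra.
  have e2 : (2 * w - y) * (w - y) = 0.
    rewrite N43 bE2 in NEq; lra.
  have wn : 2 * w - y != 0 by rewrite gt_eqF//; lra.
  have wy : w = y by apply/eqP; rewrite -subr_eq0; apply/eqP; exact: mul_eq0_neq wn e2.
  have xy2 : x ^+ 2 = y ^+ 2 by rewrite e1 wy; ring.
  have yx : y = x by apply/eqP; rewrite -(@eqrXn2 _ 2)// ?xy2//; exact: ltW.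
  by apply: Or31; rewrite wy yx.
move=> /eqP; rewrite subr_eq0 => /eqP h4b.
have hK : 2 * (b ^+ 2 + x ^+ 2 / 3) = N * (y * z).
  transitivity (N * (y + z) * y - N * y ^+ 2); last by ring.
  by rewrite h4b ey; ring.
have hw : (y + z) * w = x ^+ 2 + y ^+ 2 + z ^+ 2.
  apply: (mulfI (x := N)); last first.
    transitivity (4 * b * w); first by rewrite -h4b; ring.
    transitivity (N * (x ^+ 2 + y ^+ 2 + z ^+ 2 + w ^+ 2) - N * w ^+ 2); last by ring.
    by rewrite q ew; ring.
  by rewrite gt_eqF.
have bn : b != 0 by rewrite gt_eqF.
case: xcase => [x00|N43].
  subst x; have e1 : 2 * (y * z) = (y + z) * b by move: hw; rewrite wb; lra.
  have e2 : (4 * (y + z) - 2 * b) * (y + z) = 4.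
    apply: (mulfI bn); transitivity (N * (y + z)); last by rewrite h4b; ring.
    rewrite NE; transitivity ((4 * (2 * (y * z)) - 2 * b ^+ 2) * (y + z)); last by field.
    by rewrite e1; ring.
  have e3 : (2 * (y + z) - b) * (y + z - 2 * b) = 0.
    have q2 : 2 * (y + z) ^+ 2 - 2 * ((y + z) * b) - 2 * (y * z) + b ^+ 2 = 1.
      by rewrite -[RHS]q wb; ring.
    rewrite e1 in q2; lra.
  have pn : 2 * (y + z) - b != 0 by rewrite gt_eqF//; lra.
  have e4 := mul_eq0_neq pn e3.
  have zE : z = 2 * b - y by lra.
  have : (y - b) ^+ 2 = 0 by rewrite zE in e1; lra.
  move=> /eqP; rewrite expf_eq0 /= subr_eq0 => /eqP yb.
  by apply: Or32; split; lra.
have zE : z = 3 * b - y by rewrite N43 in h4b; lra.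
have wE : w = 2 * b by lra.
have yz2 : y * z = 2 * b ^+ 2.
  by rewrite N43 in hK NE; rewrite wE zE in hw q *; lra.
have xb2 : x ^+ 2 = b ^+ 2.
  by rewrite N43 in hK; lra.
have xbE : x = b by apply/eqP; rewrite -(@eqrXn2 _ 2)// ?xb2//; exact: ltW.
have : (y - b) * (y - 2 * b) = 0 by rewrite zE in yz2; lra.
move/eqP; rewrite mulf_eq0 !subr_eq0 => /orP[/eqP yb|/eqP yb].
  by apply: Or33; split; lra.
by exfalso; lra.
Qed.
End Algebra.

(** * Local models of the section volume *)

Section Gradient.
Variable R : realType.
Variable a : 'rV[R]_4.
Implicit Types (b v : 'rV[R]_4) (f g df dg : 'rV[R]_4 -> R).

Definition has_diff g dg := differentiable g a /\ forall v, 'd g a v = dg v :> R.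

Lemma has_diff_eq g dg dg' : has_diff g dg -> dg =1 dg' -> has_diff g dg'.
Proof. by move=> [h1 h2] e; split => // v; rewrite h2 e. Qed.

Lemma has_diff_cst (c : R) : has_diff (fun=> c) (fun=> 0).
Proof.
have H := @is_diff_cst R _ _ c a.
by split=> [|v]; [exact: ex_diff|rewrite diff_val].
Qed.

Lemma has_diff_co k : has_diff (fun b => co b k) (fun v => co v k).
Proof.
pose L : {linear 'rV[R]_4 -> R^o} := HB.pack (fun x : 'rV[R]_4 => co x k : R^o)
  (GRing.isLinear.Build _ _ _ _ _ (@co_linear R k)).
have cL : continuous L by move=> x; exact: coord_continuous.
split=> [|v]; first exact: (@linear_differentiable _ _ _ L a cL).
by rewrite -[LHS]/('d L a v) diff_lin.
Qed.

Lemma has_diffD f g df dg : has_diff f df -> has_diff g dg ->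
  has_diff (fun b => f b + g b) (fun v => df v + dg v).
Proof.
move=> [f1 f2] [g1 g2]; split=> [|v]; first exact: (differentiableD f1 g1).
by rewrite -[LHS]/('d (f + g) a v) (diffD f1 g1) -f2 -g2.
Qed.

Lemma has_diffM f g df dg : has_diff f df -> has_diff g dg ->
  has_diff (fun b => f b * g b) (fun v => f a * dg v + g a * df v).
Proof.
move=> [f1 f2] [g1 g2]; split=> [|v]; first exact: (differentiableM f1 g1).
by rewrite -[LHS]/('d (f * g) a v) (diffM f1 g1) -f2 -g2.
Qed.

Lemma has_diffV f df : has_diff f df -> f a != 0 ->
  has_diff (fun b => (f b)^-1) (fun v => - (f a) ^- 2 * df v).
Proof.
move=> [f1 f2] fa; split=> [|v]; first exact: differentiableV.
by rewrite (diffV f1 fa) -f2.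
Qed.

Lemma has_diffN f df : has_diff f df -> has_diff (fun b => - f b) (fun v => - df v).
Proof.
move=> [f1 f2]; split=> [|v]; first exact: (differentiableN f1).
by rewrite -[LHS]/('d (- f) a v) (diffN f1) -f2.
Qed.

(* The projections of the basis vectors on the tangent space are the test directions. *)
Lemma critical_gradient f g (c p0 p1 p2 p3 C d : R) : usphere a -> sphere_critical f a ->
  c != 0 ->
  has_diff g (fun v => c * (p0 * co v 0 + p1 * co v 1 + p2 * co v 2 + p3 * co v 3)) ->
  0 < d ->
  (forall b, usphere b -> `|b - a| <= d -> `|f b - g b| <= C * `|b - a| ^+ 2) ->
  let S := co a 0 * p0 + co a 1 * p1 + co a 2 * p2 + co a 3 * p3 in
  [/\ p0 = co a 0 * S, p1 = co a 1 * S, p2 = co a 2 * S & p3 = co a 3 * S].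
Proof.
move=> aS crit cn [dg dgE] d0 fg S.
have dL := sphere_diff_comparison aS dg d0 fg.
have aa : co a 0 ^+ 2 + co a 1 ^+ 2 + co a 2 ^+ 2 + co a 3 ^+ 2 = 1.
  by have := enorm_sqr a; rewrite aS expr1n dotpE => ->; ring.
have H v : orthc a v -> p0 * co v 0 + p1 * co v 1 + p2 * co v 2 + p3 * co v 3 = 0.
  move=> av; have := sphere_criticalW aS crit dL av; rewrite dgE => /eqP.
  by rewrite mulf_eq0 (negbTE cn) => /eqP.
have K (q0 q1 q2 q3 w : R) : w = co a 0 * q0 + co a 1 * q1 + co a 2 * q2 + co a 3 * q3 ->
    p0 * (q0 - w * co a 0) + p1 * (q1 - w * co a 1) + p2 * (q2 - w * co a 2) + p3 * (q3 - w * co a 3) = 0.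
  move=> wE; pose v := vec4 (q0 - w * co a 0) (q1 - w * co a 1) (q2 - w * co a 2) (q3 - w * co a 3).
  have [v0 v1 v2 v3] := co_vec4 (q0 - w * co a 0) (q1 - w * co a 1) (q2 - w * co a 2) (q3 - w * co a 3).
  have := H v; rewrite /v v0 v1 v2 v3; apply; rewrite /orthc /= dotpE v0 v1 v2 v3.
  transitivity ((co a 0 * q0 + co a 1 * q1 + co a 2 * q2 + co a 3 * q3) -
      w * (co a 0 ^+ 2 + co a 1 ^+ 2 + co a 2 ^+ 2 + co a 3 ^+ 2)); first by ring.
  by rewrite -wE aa mulr1 subrr.
rewrite /S; split.
- have := K 1 0 0 0 (co a 0); lra.
- have := K 0 1 0 0 (co a 1); lra.
- have := K 0 0 1 0 (co a 2); lra.
- have := K 0 0 0 1 (co a 3); lra.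
Qed.
End Gradient.

(** * Comparison of the section volume with rational models *)

Section Local.
Variable R : realType.
Implicit Types (a b : 'rV[R]_4) (t u : R).

(** An integral over an interval of length 2 is at most twice the largest value of the integrand. It
    is obtained from the closed form by factoring X^3 - Y^3 with X - Y <= 2 u. *)
Lemma posint2_ge0_le t u : 0 <= posint2 t u <= 2 * pos (t + `|u|) ^+ 2.
Proof.
wlog u0 : u / 0 <= u.
  move=> H; have [|un] := leP 0 u; first exact: H.
  by rewrite -posint2N -normrN; apply: H; rewrite oppr_ge0 ltW.
rewrite (ger0_norm u0) /posint2; case: eqVneq => [->|un].
  by rewrite addr0 lexx mulr_ge0 ?sqr_ge0.
have {un}u0 : 0 < u by rewrite lt_neqAle eq_sym un.
set X := pos (t + u); set Y := pos (t - u).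
have Y0 : 0 <= Y by exact: pos_ge0.
have XY : Y <= X /\ X - Y <= 2 * u.
  rewrite /X /Y; case: (posP (t + u)) => -[? ->]; case: (posP (t - u)) => -[? ->]; lra.
have [YX XYu] := XY; have X0 := le_trans Y0 YX.
have E : X ^+ 3 - Y ^+ 3 = (X - Y) * (X ^+ 2 + X * Y + Y ^+ 2) by ring.
have Q0 : 0 <= X ^+ 2 + X * Y + Y ^+ 2 by rewrite !addr_ge0 ?sqr_ge0 ?mulr_ge0.
rewrite divr_ge0 ?mulr_ge0 ?(ltW u0)//=; last by rewrite E mulr_ge0// subr_ge0.
rewrite ler_pdivrMr ?mulr_gt0// E.
have XY2 : X * Y <= X ^+ 2 by rewrite expr2 ler_wpM2l.
have Y2 : Y ^+ 2 <= X ^+ 2 by rewrite lerXn2r ?nnegrE.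
apply: (@le_trans _ _ (2 * u * (3 * X ^+ 2))); last by lra.
by apply: ler_pM => //; [rewrite subr_ge0|lra].
Qed.

(** The positive part vanishes on [-1, 1] at the base point, so after a change of 3 n in t and n in
    u it is at most 4 n, and 2 (4 n)^2 = 32 n^2. The 3 n arises because t combines three
    coordinates. *)
Lemma posint2_small t u t0 u0 n : t0 + `|u0| <= 0 -> `|t - t0| <= 3 * n -> `|u - u0| <= n ->
  `|posint2 t u| <= 32 * n ^+ 2.
Proof.
move=> h ht hu; have /andP[p0 p1] := posint2_ge0_le t u.
rewrite ger0_norm// (le_trans p1)//.
have n0 : 0 <= n by apply: le_trans hu.
have : pos (t + `|u|) <= 4 * n.
  have := ler_normD (u - u0) u0; rewrite subrK => hh.
  have := ler_norm (t - t0) => hh2.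
  by case: (posP (t + `|u|)) => -[? ->]; lra.
move=> k; have : pos (t + `|u|) ^+ 2 <= (4 * n) ^+ 2.
  by rewrite lerXn2r ?nnegrE ?pos_ge0// mulr_ge0.
lra.
Qed.

(** The section volume formula with [W] in place of the whole corner defect. *)
Definition model (W : 'rV[R]_4 -> R) b :=
  flat_density R * ((8 - W b / (co b 1 * co b 2)) / co b 3).

(** For sorted [a] the last three terms of the defect fall under [posint2_small]; with the assumed
    error of [W] this makes 4 * 32 = 128. Half of co a 1 bounds the three denominators from
    below. *)
Lemma section_vol_model a b W : usphere b -> sorted4 a -> 0 < co a 1 ->
  `|b - a| <= co a 1 / 2 ->
  `|posint2 (co b 1 + co b 2 - co b 3) (co b 0) - W b| <= 32 * `|b - a| ^+ 2 ->
  `|section_vol b - model W b| <= flat_density R * 128 / (co a 1 / 2) ^+ 3 * `|b - a| ^+ 2.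
Proof.
move=> bS [a0 a01 a12 a23] a1 ba hW.
set n := `|b - a| in ba hW *.
have n0 : 0 <= n by exact: normr_ge0.
have cn k : `|co b k - co a k| <= n.
  by have := iffLR (norm_rowP (b - a) n0) (lexx _) (inord k); rewrite -coB.
have := cn 0%N; rewrite ler_norml => /andP[l0 m0].
have := cn 1%N; rewrite ler_norml => /andP[l1 m1].
have := cn 2%N; rewrite ler_norml => /andP[l2 m2].
have := cn 3%N; rewrite ler_norml => /andP[l3 m3].
set r := co a 1 / 2 in ba *.
have r0 : 0 < r by rewrite divr_gt0.
have r1 : co a 1 = 2 * r by rewrite /r; field.
have b1 : r <= co b 1 by lra.
have b2 : r <= co b 2 by lra.
have b3 : r <= co b 3 by lra.
have b1' : 0 < co b 1 by lra. 
have b2' : 0 < co b 2 by lra.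
have b3' : 0 < co b 3 by lra.
rewrite section_volE// /model.
set D := corner_defect _ _ _ _.
have DW : `|W b - D| <= 128 * n ^+ 2.
  rewrite distrC /D /corner_defect.
  set x1 := posint2 (co b 1 + _ - _) _ in hW *; set x2 := posint2 (co b 2 - _ - _) _; set x3 := posint2 (co b 1 - co b 2 - _) _;
    set x4 := posint2 (- co b 1 - _ - _) _.
  have h2 : `|x2| <= 32 * n ^+ 2.
    apply: (@posint2_small _ _ (co a 2 - co a 1 - co a 3) (co a 0)) => //.
      by rewrite ger0_norm//; lra.
    by rewrite ler_norml; apply/andP; split; lra.
  have h3 : `|x3| <= 32 * n ^+ 2.
    apply: (@posint2_small _ _ (co a 1 - co a 2 - co a 3) (co a 0)) => //.
      by rewrite ger0_norm//; lra.
    by rewrite ler_norml; apply/andP; split; lra.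
  have h4 : `|x4| <= 32 * n ^+ 2.
    apply: (@posint2_small _ _ (- co a 1 - co a 2 - co a 3) (co a 0)) => //.
      by rewrite ger0_norm//; lra.
    by rewrite ler_norml; apply/andP; split; lra.
  have -> : x1 - x2 - x3 + x4 - W b = (x1 - W b) - x2 - x3 + x4 by ring.
  apply: (le_trans (ler_normD _ _)).
  have := ler_normB (x1 - W b - x2) x3; have := ler_normB (x1 - W b) x2; lra.
have -> : flat_density R * ((8 - D / (co b 1 * co b 2)) / co b 3) - flat_density R * ((8 - W b / (co b 1 * co b 2)) / co b 3) =
    flat_density R * (W b - D) / (co b 1 * co b 2 * co b 3).
  by field; rewrite !gt_eqF.
have k0 : 0 <= flat_density R by rewrite ltW// density_flat_gt0.
have bb : r ^+ 3 <= co b 1 * co b 2 * co b 3.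
  have -> : r ^+ 3 = r * r * r by ring.
  have r0' := ltW r0; apply: ler_pM => //; first exact: mulr_ge0.
  exact: ler_pM.
have bb0 : 0 < co b 1 * co b 2 * co b 3 by rewrite !mulr_gt0.
rewrite !normrM normfV (ger0_norm k0) (gtr0_norm bb0).
have r30 : 0 < r ^+ 3 by rewrite exprn_gt0.
rewrite ler_pdivrMr//; set B := _ * _ * _ in bb bb0 *.
have -> : flat_density R * 128 / r ^+ 3 * n ^+ 2 * B = flat_density R * (128 * (n ^+ 2 * (B / r ^+ 3))).
  by field; rewrite gt_eqF.
rewrite ler_wpM2l// (le_trans DW)// ler_wpM2l// ler_peMr ?sqr_ge0//.
by rewrite ler_pdivlMr// mul1r.
Qed.
End Local.

(** * Critical directions *)

Section Critical.
Variable R : realType.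
Implicit Types (a b v : 'rV[R]_4).

Lemma flat_density_neq0 : flat_density R != 0.
Proof. by rewrite gt_eqF// density_flat_gt0. Qed.

Lemma usphere_co a : usphere a ->
  co a 0 ^+ 2 + co a 1 ^+ 2 + co a 2 ^+ 2 + co a 3 ^+ 2 = 1.
Proof. by move=> aS; have := enorm_sqr a; rewrite aS expr1n dotpE => ->; ring. Qed.

Lemma co_near a b k : `|co b k - co a k| <= `|b - a|.
Proof.
by rewrite -coB; exact: (iffLR (norm_rowP (b - a) (normr_ge0 _)) (lexx _)).
Qed.

(** The Euler relation for [W] of degree 2 makes the model homogeneous of degree -1 at [a]. This
    identifies the Lagrange multiplier as - N / P up to the constant factor, and clearing
    denominators gives the four equations. *)
Lemma model_critical a (W : 'rV[R]_4 -> R) (w0 w1 w2 w3 d : R) :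
  usphere a -> sphere_critical (@section_vol R) a -> sorted4 a -> 0 < co a 1 ->
  has_diff a W (fun v => w0 * co v 0 + w1 * co v 1 + w2 * co v 2 + w3 * co v 3) ->
  co a 0 * w0 + co a 1 * w1 + co a 2 * w2 + co a 3 * w3 = 2 * W a ->
  0 < d ->
  (forall b, `|b - a| <= d ->
    `|posint2 (co b 1 + co b 2 - co b 3) (co b 0) - W b| <= 32 * `|b - a| ^+ 2) ->
  let N := 8 * (co a 1 * co a 2) - W a in
  [/\ N * co a 0 ^+ 2 = co a 0 * w0, N * co a 1 ^+ 2 = co a 1 * w1 - W a,
      N * co a 2 ^+ 2 = co a 2 * w2 - W a & N * co a 3 ^+ 2 = co a 3 * w3 + N].
Proof.
move=> aS crit srt a1 hW euler d0 near N.
have [_ _ a12 a23] := srt.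
have a2 : 0 < co a 2 by exact: lt_le_trans a12.
have a3 : 0 < co a 3 by exact: lt_le_trans a23.
have n1 : co a 1 != 0 by rewrite gt_eqF.
have n2 : co a 2 != 0 by rewrite gt_eqF.
have n3 : co a 3 != 0 by rewrite gt_eqF.
pose P := co a 1 * co a 2 * co a 3.
have nP : P != 0 by rewrite !mulf_neq0.
pose p0 := - w0 / P; pose p1 := (W a / co a 1 - w1) / P.
pose p2 := (W a / co a 2 - w2) / P; pose p3 := (- w3 - N / co a 3) / P.
have hm : has_diff a (model W)
    (fun v => flat_density R * (p0 * co v 0 + p1 * co v 1 + p2 * co v 2 + p3 * co v 3)).
  have h12 := has_diffV (has_diffM (has_diff_co a 1) (has_diff_co a 2)) (mulf_neq0 n1 n2).
  have h := has_diffM (has_diff_cst a (flat_density R)) (has_diffM (has_diffD (has_diff_cst a 8)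
    (has_diffN (has_diffM hW h12))) (has_diffV (has_diff_co a 3) n3)).
  apply: (has_diff_eq h) => v; rewrite /p0 /p1 /p2 /p3 /N /P.
  by field; rewrite n1 n2 n3.
have e0 : 0 < Num.min d (co a 1 / 2) by rewrite lt_min d0 divr_gt0.
have appr b : usphere b -> `|b - a| <= Num.min d (co a 1 / 2) ->
    `|section_vol b - model W b| <= flat_density R * 128 / (co a 1 / 2) ^+ 3 * `|b - a| ^+ 2.
  move=> bS; rewrite le_min => /andP[bd ba].
  by apply: section_vol_model => //; exact: near.
have [] := critical_gradient aS crit flat_density_neq0 hm e0 appr.
have -> : co a 0 * p0 + co a 1 * p1 + co a 2 * p2 + co a 3 * p3 = - N / P.
  transitivity ((2 * W a - (co a 0 * w0 + co a 1 * w1 + co a 2 * w2 + co a 3 * w3) - N) / P).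
    by rewrite /p0 /p1 /p2 /p3 /N /P; field; rewrite n1 n2 n3.
  by rewrite euler subrr sub0r.
have K (x p q : R) : p = x * (- N / P) -> p * P = q -> N * x ^+ 2 = - (x * q).
  by move=> -> <-; field.
move=> h0 h1 h2 h3; split.
- rewrite (K _ _ (- w0) h0); last by rewrite /p0 divfK.
  by ring.
- rewrite (K _ _ (W a / co a 1 - w1) h1); last by rewrite /p1 divfK.
  by field.
- rewrite (K _ _ (W a / co a 2 - w2) h2); last by rewrite /p2 divfK.
  by field.
- rewrite (K _ _ (- w3 - N / co a 3) h3); last by rewrite /p3 divfK.
  by field.
Qed.

(** Nearby sections have volume c * 8 / b_4, whose gradient is a nonzero multiple of the last basis
    vector; criticality makes it parallel to [a]. *)
Lemma critical_full a : usphere a -> sphere_critical (@section_vol R) a ->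
  co a 0 = 0 -> co a 1 = 0 -> 0 <= co a 2 -> co a 2 < co a 3 -> co a 2 = 0.
Proof.
move=> aS crit a0 a1 a2 a23.
have a3 : 0 < co a 3 by exact: le_lt_trans a23.
have n3 : co a 3 != 0 by rewrite gt_eqF.
have hg : has_diff a (fun b => flat_density R * (8 * (co b 3)^-1))
    (fun v => flat_density R * (0 * co v 0 + 0 * co v 1 + 0 * co v 2 + (- 8 / co a 3 ^+ 2) * co v 3)).
  have h := has_diffM (has_diff_cst a (flat_density R))
    (has_diffM (has_diff_cst a 8) (has_diffV (has_diff_co a 3) n3)).
  by apply: (has_diff_eq h) => v; field.
pose d := (co a 3 - co a 2) / 4; have d0 : 0 < d by rewrite divr_gt0// subr_gt0.
have appr b : usphere b -> `|b - a| <= d ->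
    `|section_vol b - flat_density R * (8 * (co b 3)^-1)| <= 0 * `|b - a| ^+ 2.
  move=> bS bd; have cn k := le_trans (co_near a b k) bd.
  have := cn 0%N; rewrite a0 subr0 => h0.
  have := cn 1%N; rewrite a1 subr0 => h1.
  have h2 : `|co b 2| <= co a 2 + d.
    rewrite -[co b 2](subrK (co a 2)) (le_trans (ler_normD _ _))// (ger0_norm a2).
    by rewrite addrC lerD2l.
  have := cn 3%N; rewrite ler_norml => /andP[h3 _].
  have dE : co a 3 = co a 2 + 4 * d by rewrite /d; field.
  rewrite section_vol_full//; [|lra|lra].
  by rewrite subrr normr0 mul0r.
have [_ _ h _] := critical_gradient aS crit flat_density_neq0 hg d0 appr.
move: h; rewrite !mulr0 !add0r mulrC => /esym h.
apply: (mul_eq0_neq _ h).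
by rewrite mulf_neq0// mulf_neq0 ?oppr_eq0 ?pnatr_eq0// invr_neq0// expf_neq0.
Qed.

Lemma inv_sqrt_unique (k : nat) (t : R) : (0 < k)%N -> 0 <= t -> k%:R * t ^+ 2 = 1 ->
  t = (Num.sqrt k%:R)^-1.
Proof.
move=> k0 t0 kt; have kn : k%:R != 0 :> R by rewrite pnatr_eq0 -lt0n.
have kE : k%:R^-1 = t ^+ 2 by apply: (mulfI kn); rewrite kt mulfV.
by rewrite -sqrtrV ?ler0n// kE sqrtr_sqr ger0_norm.
Qed.

(** Sorting puts the nonzero coordinates last, [diag_vec] puts them first; the reversal of indices
    connects the two. *)
Lemma kdiagonal_rev (k : nat) (t : R) a : (0 < k)%N -> 0 <= t -> k%:R * t ^+ 2 = 1 ->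
  (forall j, (j < 4)%N -> co a j = if (3 - j < k)%N then t else 0) -> is_kdiagonal k a.
Proof.
move=> k0 t0 kt aE; exists (perm (@rev_ord_inj 4)), (fun=> false) => i.
rewrite expr0 mul1r permE mxE /= -(inv_sqrt_unique k0 t0 kt).
by have := aE i (ltn_ord i); rewrite /co inord_val subSS.
Qed.

Lemma sorted_critical a : usphere a -> sphere_critical (@section_vol R) a -> sorted4 a ->
  is_diagonal a \/ eq_upto_perm_sign a (vec1122 R).
Proof.
move=> aS crit srt; have [a0 a01 a12 a23] := srt.
have q := usphere_co aS.
have [a1|a1] := leP (co a 1) 0.
  left.
  have a10 : co a 1 = 0 by apply/eqP; rewrite eq_le a1 (le_trans a0).
  have a00 : co a 0 = 0 by apply/eqP; rewrite eq_le a0 -a10 a01.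
  rewrite a10 a00 in q; rewrite a10 in a12.
  (* Equality is the 2-diagonal case, concluded directly. Otherwise the strict inequality keeps all
     nearby sections full. *)
  have [e23|n23] := eqVneq (co a 3) (co a 2).
    exists 2%N => //; apply: (@kdiagonal_rev 2 (co a 2)) => //.
      by rewrite -[RHS]q e23; ring.
    by case=> [|[|[|[|]]]].
  have lt23 : co a 2 < co a 3 by rewrite lt_neqAle eq_sym n23.
  have a20 := critical_full aS crit a00 a10 a12 lt23.
  rewrite a20 in q lt23; exists 1%N => //; apply: (@kdiagonal_rev 1 (co a 3)) => //.
  - exact: ltW.
  - by rewrite -[RHS]q; ring.
  - by case=> [|[|[|[|]]]].
set x := co a 0 in q a0 a01; set y := co a 1 in q a01 a12 a1.
set z := co a 2 in q a12 a23; set w := co a 3 in q a23.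
have diag4 : y = x -> z = x -> w = x -> is_diagonal a.
  move=> yx zx wx; exists 4%N => //; apply: (@kdiagonal_rev 4 x) => //.
    by rewrite -[RHS]q yx zx wx; ring.
  by case=> [|[|[|[|]]]].
have v1122 : y = x -> z = 2 * x -> w = 2 * x -> eq_upto_perm_sign a (vec1122 R).
  move=> yx zx wx; have xE : x = (Num.sqrt 10)^-1.
    by apply: inv_sqrt_unique => //; rewrite -[RHS]q yx zx wx; ring.
  exists 1%g, (fun=> false) => i; rewrite expr0 mul1r perm1 !mxE -xE.
  case: (ord4E i) => ->; rewrite inordK//= -/(co a _).
  - by rewrite mulr1.
  - by rewrite mulr1 -yx.
  - by rewrite mulrC -zx.
  - by rewrite mulrC -wx.
have cE (k : nat) b (d : R) : `|b - a| <= d -> `|co b k - co a k| <= d.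
  exact: le_trans (co_near _ _ _).
pose s0 := y + z - w.
(* The wall x = s0 is included: after [posint2_compl] the error term has argument - s0, and - s0 + x
   <= 0 makes it quadratically small. *)
have [xb|xb] := leP x s0.
  pose W b := 2 * (co b 1 + co b 2 + - co b 3) ^+ 2 + 2 / 3 * co b 0 ^+ 2 : R.
  have hW : has_diff a W (fun v => 4 / 3 * x * co v 0 + 4 * s0 * co v 1 +
      4 * s0 * co v 2 + (- 4 * s0) * co v 3).
    have hs := has_diffD (has_diffD (has_diff_co a 1) (has_diff_co a 2)) (has_diffN (has_diff_co a 3)).
    have h := has_diffD (has_diffM (has_diff_cst a 2) (has_diffM hs hs))
      (has_diffM (has_diff_cst a (2 / 3)) (has_diffM (has_diff_co a 0) (has_diff_co a 0))).
    by apply: (has_diff_eq h) => v; rewrite /s0 /x /y /z /w; field.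
  have near b : `|b - a| <= 1 ->
      `|posint2 (co b 1 + co b 2 - co b 3) (co b 0) - W b| <= 32 * `|b - a| ^+ 2.
    move=> _; rewrite posint2_compl /W.
    set A := posint2 _ _.
    have -> : 2 * (co b 1 + co b 2 - co b 3) ^+ 2 + 2 / 3 * co b 0 ^+ 2 - A -
      (2 * (co b 1 + co b 2 - co b 3) ^+ 2 + 2 / 3 * co b 0 ^+ 2) = - A by ring.
    rewrite normrN; apply: (@posint2_small _ _ _ (- s0) x).
    - by rewrite ger0_norm// addrC subr_le0.
    - have := co_near a b 1; have := co_near a b 2; have := co_near a b 3.
      rewrite !ler_norml /s0 -/y -/z -/w => /andP[? ?] /andP[? ?] /andP[? ?].
      by apply/andP; split; lra.
    - exact: co_near.
  have := model_critical aS crit srt a1 hW _ ltr01 near.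
  rewrite -/x -/y -/z -/w.
  have WE : W a = 2 * (s0 ^+ 2 + x ^+ 2 / 3) by rewrite /W /s0 /x /y /z /w; field.
  rewrite WE => -[]; first by rewrite /s0; field.
  move=> e0 e1 e2 e3.
  have [] := @critical_even _ x y z w s0 (8 * (y * z) - 2 * (s0 ^+ 2 + x ^+ 2 / 3)) a0 a01 a1 a12 a23
     erefl xb erefl q.
  - by rewrite e0; ring.
  - by rewrite e1; ring.
  - by rewrite e2; ring.
  - by rewrite e3; ring.
  - by move=> [yx zx wx]; left; exact: diag4.
  - move=> [x0 zy wy]; left; exists 3%N => //; apply: (@kdiagonal_rev 3 y) => //.
    + exact: ltW.
    + by rewrite -[RHS]q x0 zy wy; ring.
    + by case=> [|[|[|[|]]]].
  - by move=> [yx zx wx]; right; exact: v1122.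
(* Here W = 0, and the equation for y reads 8 y z y^2 = 0, which is impossible. *)
have [sx|sx] := leP s0 (- x).
  exfalso.
  have hW : has_diff a (fun=> 0) (fun v => 0 * co v 0 + 0 * co v 1 + 0 * co v 2 + 0 * co v 3).
    by apply: (has_diff_eq (has_diff_cst a 0)) => v; rewrite !mul0r !addr0.
  have near b : `|b - a| <= 1 ->
      `|posint2 (co b 1 + co b 2 - co b 3) (co b 0) - 0| <= 32 * `|b - a| ^+ 2.
    move=> _; rewrite subr0; apply: (@posint2_small _ _ _ s0 x).
    - by rewrite ger0_norm//; lra.
    - have := co_near a b 1; have := co_near a b 2; have := co_near a b 3.
      rewrite !ler_norml /s0 -/y -/z -/w => /andP[? ?] /andP[? ?] /andP[? ?].
      by apply/andP; split; lra.
    - exact: co_near.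
  have := model_critical aS crit srt a1 hW _ ltr01 near.
  rewrite !mulr0 !addr0 !subr0 -/y -/z => -[]// _ e1 _ _.
  have z0 : 0 < z by exact: lt_le_trans a12.
  have : 0 < 8 * (y * z) * y ^+ 2 by rewrite !mulr_gt0// exprn_gt0.
  by rewrite e1 ltxx.
have x0 : 0 < x by lra.
have xn : x != 0 by rewrite gt_eqF.
pose s := x + y + z - w; have s_gt0 : 0 < s by rewrite /s; move: sx; rewrite /s0; lra.
pose W b := (co b 1 + co b 2 + - co b 3 + co b 0) ^+ 3 * (3 * co b 0)^-1 : R.
have hW : has_diff a W (fun v => (s ^+ 2 / x - s ^+ 3 / (3 * x ^+ 2)) * co v 0 +
    s ^+ 2 / x * co v 1 + s ^+ 2 / x * co v 2 + (- (s ^+ 2 / x)) * co v 3).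
  have hs := has_diffD (has_diffD (has_diffD (has_diff_co a 1) (has_diff_co a 2))
    (has_diffN (has_diff_co a 3))) (has_diff_co a 0).
  have n3 : 3 * co a 0 != 0 by rewrite mulf_neq0// pnatr_eq0.
  have h := has_diffM (has_diffM hs (has_diffM hs hs))
    (has_diffV (has_diffM (has_diff_cst a 3) (has_diff_co a 0)) n3).
  by apply: (has_diff_eq h) => v; rewrite /s /x /y /z /w; field.
(* x - s0 and s0 + x are signed sums of four coordinates, so moving each by at most an eighth of
   these gaps preserves their signs, and x / 8 keeps the first coordinate positive. On this
   neighbourhood [W] equals the [posint2] term exactly. *)
pose d := Num.min (x / 8) (Num.min ((x - s0) / 8) ((s0 + x) / 8)).
have d0 : 0 < d by rewrite !lt_min; apply/and3P; split; rewrite divr_gt0//; lra.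
have near b : `|b - a| <= d ->
    `|posint2 (co b 1 + co b 2 - co b 3) (co b 0) - W b| <= 32 * `|b - a| ^+ 2.
  move=> bd; move: (bd); rewrite !le_min => /and3P[d1 d2 d3].
  have := co_near a b 0; have := co_near a b 1; have := co_near a b 2; have := co_near a b 3.
  rewrite !ler_norml -/x -/y -/z -/w => /andP[? ?] /andP[? ?] /andP[? ?] /andP[? ?].
  have b0 : co b 0 != 0 by rewrite gt_eqF//; lra.
  have k1 : pos (co b 1 + co b 2 - co b 3 + co b 0) = co b 1 + co b 2 - co b 3 + co b 0.
    by case: (posP (co b 1 + co b 2 - co b 3 + co b 0)) => -[? ->]//; rewrite /s0 in d3; lra.
  have k2 : pos (co b 1 + co b 2 - co b 3 - co b 0) = 0.
    by case: (posP (co b 1 + co b 2 - co b 3 - co b 0)) => -[? ->]//; rewrite /s0 in d2; lra.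
  rewrite /posint2 (negbTE b0) k1 k2 expr0n /= subr0 /W subrr oppr_le0 andbb.
  by rewrite mulr_ge0// sqr_ge0.
have := model_critical aS crit srt a1 hW _ d0 near.
rewrite -/x -/y -/z -/w.
have WE : W a = s ^+ 3 / (3 * x) by rewrite /W /s /x /y /z /w; field.
rewrite WE => -[]; first by rewrite /s; field.
move=> e0 e1 e2 e3.
(* Multiplication by 3 x clears the denominator of [W] and yields the equations of
   [critical_mixed]. *)
have NE : 24 * (x * y * z) - s ^+ 3 = 3 * x * (8 * (y * z) - s ^+ 3 / (3 * x)) by field.
have KN (u v : R) : (8 * (y * z) - s ^+ 3 / (3 * x)) * u = v ->
    (24 * (x * y * z) - s ^+ 3) * u = 3 * x * v by move=> <-; rewrite NE -[LHS]mulrA.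
have [] := @critical_mixed _ x y z w s (24 * (x * y * z) - s ^+ 3) x0 a01 a12 a23 erefl s_gt0 erefl q.
- by rewrite (KN _ _ e0); field.
- by rewrite (KN _ _ e1); field.
- by rewrite (KN _ _ e2); field.
- by rewrite (KN _ _ e3); field.
- by move=> [yx zx wx]; left; exact: diag4.
- by move=> [yx zx wx]; right; exact: v1122.
Qed.
End Critical.

Theorem theorem3 (R : realType) (a : 'rV[R]_4) (ha : critical_direction a) :
  is_diagonal a \/ eq_upto_perm_sign a (vec1122 R).
Proof.
have [s [e srt]] := sorting_sperm a.
have [bS crit] := critical_direction_sperm s e ha.
case: (sorted_critical bS crit srt) => [[k kn hk]|h]; [left|right].
  by exists k => //; exact: eq_upto_perm_sign_sperm hk.
exact: eq_upto_perm_sign_sperm h.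
Qed.
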